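(* Let $\mathbb{N}^n$ be the free commutative monoid on generators $a_1,\dots,a_n$, and let $F:(\mathfrak F\mathbb{N}^n)^{op}\to\mathrm{Ab}$ be a contravariant natural system on $\mathbb{N}^n$. Then for all $k\geqslant 0$, $$H_k(\mathbb{N}^n,F)\cong H_k(T^n_*,\overline F).$$
   Context: For a monoid $M$ (viewed as a one-object category), the factorization category $\mathfrak F M$ has the elements of $M$ as objects; a morphism $\alpha\to\beta$ is a pair $(f,g)$ of elements of $M$ with $g\alpha f=\beta$; the composite of $(f_1,g_1):\alpha\to\beta$ and $(f_2,g_2):\beta\to\gamma$ is $(f_1f_2,g_2g_1)$, and the identity is $(1,1)$. A contravariant natural system on $M$ is a functor $F:(\mathfrak FM)^{op}\to\mathrm{Ab}$, and the Leech homology is $H_k(M,F)=\varinjlim{}_k^{(\mathfrak FM)^{op}}F$, where for a small category $\mathcal C$ and $G:\mathcal C\to\mathrm{Ab}$, $\varinjlim{}_k^{\mathcal C}G$ is the $k$-th left derived functor of the colimit (equivalently the $k$-th homology of the complex $\bigoplus_{c_0\to\cdots\to c_k}G(c_0)$ with the standard alternating-face differential). Precubical sets, the category $\Box_+$ with face maps $\delta_i^{k,\varepsilon}$, the category of singular cubes $\Box_+/X$, homological systems and the homology $H_k(X,G)$ of a precubical set with coefficients in a homological system $G:(\Box_+/X)^{op}\to\mathrm{Ab}$ are as follows: $\Box_+$ has objects $\{0,1\}^m$ and morphisms generated by $\delta_i^{m,\varepsilon}$ (insert $\varepsilon$ at position $i$); a precubical set is a functor $X:\Box_+^{op}\to\mathrm{Set}$,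 $X_m=X(\{0,1\}^m)$, $\partial_i^{m,\varepsilon}=X(\delta_i^{m,\varepsilon})$; $\Box_+/X$ has objects the elements $\sigma\in X_m$ and morphisms $(f,\sigma,\tau)$ with $X(f)(\tau)=\sigma$; $H_k(X,G)$ is the homology of $\bigoplus_{\sigma\in X_k}G(\sigma)$ with $d_k=\sum_{i=1}^k(-1)^i(d_i^{k,1}-d_i^{k,0})$, $d_i^{k,\varepsilon}$ sending $G(\sigma)$ to $G(\partial_i^{k,\varepsilon}\sigma)$ via $G(\delta_i^{k,\varepsilon},\partial_i^{k,\varepsilon}\sigma,\sigma)$. The precubical set $T^n_*$ has $T^n_k=\{a_{i_1}a_{i_2}\cdots a_{i_k}:1\leqslant i_1<\dots<i_k\leqslant n\}$ (so $T^n_0=\{1\}$) and $\partial_s^{k,0}(a_{i_1}\cdots a_{i_k})=\partial_s^{k,1}(a_{i_1}\cdots a_{i_k})=a_{i_1}\cdots\widehat{a_{i_s}}\cdots a_{i_k}$. The homological system $\overline F$ on $T^n_*$ is the unique functor $(\Box_+/T^n_* )^{op}\to\mathrm{Ab}$ with $\overline F(a_{i_1}\cdots a_{i_k})=F(a_{i_1}\cdots a_{i_k})$ (the product regarded as an element of $\mathbb N^n$) and sending the face morphism $(\delta_s^{k,0},a_{i_1}\cdots\widehat{a_{i_s}}\cdots a_{i_k},a_{i_1}\cdots a_{i_k})$ to $F$ of the morphism $(a_{i_s},1):a_{i_1}\cdots\widehat{a_{i_s}}\cdots a_{i_k}\to a_{i_1}\cdots a_{i_k}$ of $\mathfrak F\mathbb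 N^n$, and the face morphism with $\delta_s^{k,1}$ to $F$ of the morphism $(1,a_{i_s})$. *)

(* Defs.v *)
From HB Require Import structures.
From mathcomp Require Import all_boot all_order all_algebra.
Set Implicit Arguments. Unset Strict Implicit. Unset Printing Implicit Defensive.
Import GRing.Theory.

(* The free commutative monoid N^n on a_1,...,a_n (indexed by 'I_n),         *)
(* written additively: an element is a vector of exponents.                  *)
Notation vec n := {ffun 'I_n -> nat}.

Definition vadd n (a b : vec n) : vec n := [ffun i => a i + b i].
Definition v0 n : vec n := [ffun => 0].
Definition gen n (i : 'I_n) : vec n := [ffun j => nat_of_bool (j == i)].
Definition vle n (a b : vec n) : bool := [forall i, a i <= b i].
Definition vsub n (a b : vec n) : vec n := [ffun i => a i - b i].

(* Contravariant natural systems F : (F N^n)^op -> Ab.                        *)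
(* A morphism alpha -> beta of the factorization category is a pair (f,g)     *)
(* with g alpha f = beta; F sends it to an additive map F beta -> F alpha.    *)
(* Composite of (f1,g1) : alpha -> beta and (f2,g2) : beta -> gamma is        *)
(* (f1 f2, g2 g1); identity is (1,1).                                         *)
Local Unset Implicit Arguments.
Record natsys (n : nat) := NatSys {
  Fob :> vec n -> zmodType;
  Fmor : forall (al be f g : vec n), vadd (vadd g al) f = be -> Fob be -> Fob al;
  Fmor_add : forall (al be f g : vec n) h (u v : Fob be),
      Fmor al be f g h (u + v)%R = (Fmor al be f g h u + Fmor al be f g h v)%R;
  Fmor_id : forall (al : vec n) h (u : Fob al), Fmor al al (v0 n) (v0 n) h u = u;
  Fmor_comp : forall (al be ga f1 g1 f2 g2 : vec n) h1 h2 h12 (u : Fob ga),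
      Fmor al ga (vadd f1 f2) (vadd g2 g1) h12 u
      = Fmor al be f1 g1 h1 (Fmor be ga f2 g2 h2 u)
}.
Local Set Implicit Arguments.
Arguments Fob {n} _ : rename.
Arguments Fmor {n} F al be f g _ _ : rename.

Definition Fm n (F : natsys n) (al be f g : vec n) : F be -> F al :=
  match @eqP _ (vadd (vadd g al) f) be with
  | ReflectT h => Fmor F al be f g h
  | ReflectF _ => fun _ => 0%R
  end.

Arguments Fm {n} F al be f g _.

Definition sgn (V : zmodType) (i : nat) (v : V) : V := if odd i then (- v)%R else v.

(* Isomorphism of subquotients Z_X/B_X ~= Z_Y/B_Y (B_X <= Z_X subgroups of an *)
(* abelian group X, likewise for Y), expressed through the graph of the      *)
(* isomorphism lifted to cycles: an additive relation R between Z_X and Z_Y,  *)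
(* total in both directions, with R x y -> (x in B_X <-> y in B_Y).           *)
(* (Such an R is exactly {(x,y) | phi[x] = [y]} for an isomorphism phi.)      *)
Definition subquot_iso (X Y : Type)
    (zX : X) (aX : X -> X -> X) (nX : X -> X) (ZX BX : X -> Prop)
    (zY : Y) (aY : Y -> Y -> Y) (nY : Y -> Y) (ZY BY : Y -> Prop) : Prop :=
  exists R : X -> Y -> Prop,
    R zX zY /\
    (forall x y x' y', R x y -> R x' y' -> R (aX x x') (aY y y')) /\
    (forall x y, R x y -> R (nX x) (nY y)) /\
    (forall x y, R x y -> ZX x /\ ZY y) /\
    (forall x, ZX x -> exists y, R x y) /\
    (forall y, ZY y -> exists x, R x y) /\
    (forall x y, R x y -> (BX x <-> BY y)).

(* Leech homology H_k(N^n, F): homology of the complex                        *)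
(*   C_k = (+)_{c0 -> c1 -> ... -> ck in (F N^n)^op} F(c0)                     *)
(* with d = sum_{i=0}^k (-1)^i d_i.  A chain c0 -> ... -> ck of (F N^n)^op is  *)
(* a sequence of morphisms (f_i,g_i) : c_i -> c_{i-1} of F N^n, so it is       *)
(* determined by c0 and the list [(f_1,g_1);...;(f_k,g_k)], subject to        *)
(* g_i c_i f_i = c_{i-1}, i.e. c_i = c_{i-1} - f_i - g_i with f_i+g_i <= c_{i-1}.*)
(* An element of the direct sum is a finitely supported function             *)
(* x : forall c0, list -> F c0 vanishing off the valid chains of length k.    *)
Definition P n := (vec n * vec n)%type.

Fixpoint valid n (al : vec n) (p : seq (P n)) : bool :=
  match p with
  | [::] => true
  | fg :: q => vle (vadd fg.1 fg.2) al && valid (vsub al (vadd fg.1 fg.2)) q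
  end.

(* composition of the consecutive morphisms at positions j, j+1 (0-based):   *)
(* (f_{j+1},g_{j+1}) then (f_j,g_j) composes to (f_{j+1} f_j, g_j g_{j+1})   *)
Fixpoint mergeAt n (j : nat) (p : seq (P n)) : seq (P n) :=
  match j, p with
  | 0, a :: b :: q => (vadd b.1 a.1, vadd a.2 b.2) :: q
  | j'.+1, a :: q => a :: mergeAt j' q
  | _, _ => p
  end.

Definition LC n (F : natsys n) := forall al : vec n, seq (P n) -> F al.

Definition LC0 n (F : natsys n) : LC F := fun al p => 0%R.
Definition LCadd n (F : natsys n) (x y : LC F) : LC F := fun al p => (x al p + y al p)%R.
Definition LCopp n (F : natsys n) (x : LC F) : LC F := fun al p => (- x al p)%R.

Definition LsuppBy n (F : natsys n) (L : seq (vec n * seq (P n))) (x : LC F) : Prop :=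
  forall al p, (al, p) \notin L -> x al p = 0%R.

Definition Lchain n (F : natsys n) (k : nat) (x : LC F) : Prop :=
  (exists L, LsuppBy L x) /\
  (forall al p, ~~ (valid al p && (size p == k)) -> x al p = 0%R).

(* d_{k+1} x, computed with the help of a finite list L containing the support *)
Definition LD n (F : natsys n) (k : nat) (L : seq (vec n * seq (P n))) (x : LC F) : LC F :=
  fun be q =>
  ((* face 0 : drop c0, map along F(c1 -> c0) *)
   \sum_(fg <- undup [seq head (v0 n, v0 n) e.2 | e <- L])
      Fmor F be (vadd (vadd fg.2 be) fg.1) fg.1 fg.2 erefl
           (x (vadd (vadd fg.2 be) fg.1) (fg :: q))
   (* faces 1..k : compose two consecutive morphisms *)
   + \sum_(j < k) sgn j.+1 (\sum_(p <- undup [seq e.2 | e <- L] | mergeAt j p == q) x be p)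
   (* face k+1 : drop the last object *)
   + sgn k.+1 (\sum_(p <- undup [seq e.2 | e <- L] | (size p == k.+1) && (take k p == q))
                 x be p))%R.

Definition LBd n (F : natsys n) (k : nat) (x y : LC F) : Prop :=
  forall L, LsuppBy L x -> forall be q, y be q = LD k L x be q.

Definition Lcycle n (F : natsys n) (k : nat) (x : LC F) : Prop :=
  Lchain k x /\ (match k with 0 => True | k'.+1 => LBd k' x (LC0 F) end).

Definition Lbound n (F : natsys n) (k : nat) (x : LC F) : Prop :=
  Lchain k x /\ exists y, Lchain k.+1 y /\ LBd k y x.

(* Homology of the precubical set T^n_* with coefficients in Fbar.            *)
(* T^n_k = k-element subsets S of {a_1..a_n}; Fbar(S) = F(prod_{i in S} a_i).  *)
(* d = sum_{s=1}^k (-1)^s (d_s^1 - d_s^0), d_s^0 via F(a_{i_s},1),             *)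
(* d_s^1 via F(1,a_{i_s}).  Here S = T u {i}, and s = position of i in S.     *)
Definition ind n (S : {set 'I_n}) : vec n := [ffun i => nat_of_bool (i \in S)].

Definition CC n (F : natsys n) := forall S : {set 'I_n}, F (ind S).
Definition CC0 n (F : natsys n) : CC F := fun S => 0%R.
Definition CCadd n (F : natsys n) (x y : CC F) : CC F := fun S => (x S + y S)%R.
Definition CCopp n (F : natsys n) (x : CC F) : CC F := fun S => (- x S)%R.

Definition Cchain n (F : natsys n) (k : nat) (x : CC F) : Prop :=
  forall S : {set 'I_n}, #|S| != k -> x S = 0%R.

Definition CD n (F : natsys n) (x : CC F) : CC F :=
  fun T => (\sum_(i : 'I_n | i \notin T)
     sgn (#|[set j in T | (j < i)%N]|).+1
       (Fm F (ind T) (ind (i |: T)) (v0 n) (gen i) (x (i |: T))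
        - Fm F (ind T) (ind (i |: T)) (gen i) (v0 n) (x (i |: T))))%R.

Definition Ccycle n (F : natsys n) (k : nat) (x : CC F) : Prop :=
  Cchain k x /\ forall T : {set 'I_n}, CD x T = 0%R.

Definition Cbound n (F : natsys n) (k : nat) (x : CC F) : Prop :=
  Cchain k x /\ exists y, Cchain k.+1 y /\ forall T, x T = CD y T.

Arguments LC0 {n} F.
Arguments CC0 {n} F.
Arguments Lcycle {n} F k x.
Arguments Lbound {n} F k x.
Arguments Ccycle {n} F k x.
Arguments Cbound {n} F k x.

(* Main.v *)
(* Let C be the factorization category of N^n. Both complexes compute Tor over C
   of F and the constant system Z: the Leech complex comes from the bar
   resolution, the cubical one from the tensor product over the n coordinates of
   the resolutions [d (f, g) = (f, g + 1) - (f + 1, g)] over the factorization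
   category of N. They are compared through the double complex whose (p, q) part
   is spanned by the chains of p + 1 morphisms of C starting at a cube
   a_{i_1} ... a_{i_q}, with coefficients in F of the target; chains of length 0
   form the cubical complex, and forgetting the first morphism of the chains
   with q = 0 gives the Leech complex. The extra degeneracy contracts the rows,
   sliding units from g to f one coordinate after the other contracts the
   columns, and both contractions leave the coefficients alone. A Leech cycle x
   and a cubical cycle y correspond to each other when some chain of the double
   complex has total boundary y and augmentation x. *)

Require Import Defs.
From HB Require Import structures.
From mathcomp Require Import all_boot all_order all_algebra.
From mathcomp.classical Require Import boolp.
From mathcomp Require Import zify.

Set Implicit Arguments.
Unset Strict Implicit.
Unset Printing Implicit Defensive.

Import GRing.Theory.
Local Open Scope ring_scope.

(** * Finite sums and direct sums of abelian groups *)

Lemma eq_big_supp (V : zmodType) (I : eqType) (s t : seq I) (G : I -> V) :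
  uniq s -> uniq t ->
  (forall i, i \in s -> i \notin t -> G i = 0) ->
  (forall i, i \in t -> i \notin s -> G i = 0) ->
  \sum_(i <- s) G i = \sum_(i <- t) G i.
Proof.
move=> us ut Gs Gt; transitivity (\sum_(i <- s | i \in t) G i).
  by rewrite [RHS]big_rmcond_in.
transitivity (\sum_(i <- t | i \in s) G i); last by rewrite [LHS]big_rmcond_in.
rewrite -[LHS]big_filter -[RHS]big_filter; apply: perm_big.
by apply: uniq_perm; rewrite ?filter_uniq // => i; rewrite !mem_filter andbC.
Qed.

Section DirectSum.

Variables (I : eqType) (A : I -> zmodType).

(** The finite support is only asserted to exist, so elements are equal as soon as their
    coefficients are; classical logic supplies decidable equality and choice. *)
Record dsum := DSum {
  dcoef :> forall i, A i;
  dsumP : exists s : seq I, forall i, i \notin s -> dcoef i = 0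
}.

HB.instance Definition _ := gen_eqMixin dsum.
HB.instance Definition _ := gen_choiceMixin dsum.

Lemma dsum_ext (x y : dsum) : (forall i, x i = y i) -> x = y.
Proof.
case: x y => [f hf] [g hg] /= fg.
have E : f = g by apply: functional_extensionality_dep.
by subst g; congr DSum; exact: Prop_irrelevance.
Qed.

Lemma dzero_subproof : exists s : seq I, forall i, i \notin s -> (0 : A i) = 0.
Proof. by exists [::]. Qed.
Definition dzero : dsum := DSum dzero_subproof.

Lemma dopp_subproof (x : dsum) :
  exists s : seq I, forall i, i \notin s -> - x i = 0.
Proof. by have [s xs] := dsumP x; exists s => i /xs ->; rewrite oppr0. Qed.
Definition dopp x : dsum := DSum (dopp_subproof x).

Lemma dadd_subproof (x y : dsum) :
  exists s : seq I, forall i, i \notin s -> x i + y i = 0.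
Proof.
have [s xs] := dsumP x; have [t yt] := dsumP y; exists (s ++ t) => i.
by rewrite mem_cat negb_or => /andP[/xs-> /yt->]; rewrite addr0.
Qed.
Definition dadd x y : dsum := DSum (dadd_subproof x y).

Lemma daddA : associative dadd.
Proof. by move=> x y z; apply: dsum_ext => i /=; rewrite addrA. Qed.
Lemma daddC : commutative dadd.
Proof. by move=> x y; apply: dsum_ext => i /=; rewrite addrC. Qed.
Lemma dadd0 : left_id dzero dadd.
Proof. by move=> x; apply: dsum_ext => i /=; rewrite add0r. Qed.
Lemma daddN : left_inverse dzero dopp dadd.
Proof. by move=> x; apply: dsum_ext => i /=; rewrite addNr. Qed.

HB.instance Definition _ := GRing.isZmodule.Build dsum daddA daddC dadd0 daddN.

Definition coef i (x : dsum) : A i := x i.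

Lemma coef_is_zmod_morphism i : zmod_morphism (coef i).
Proof. by []. Qed.
HB.instance Definition _ i :=
  GRing.isZmodMorphism.Build dsum (A i) (coef i) (coef_is_zmod_morphism i).

Definition single i (u : A i) (j : I) : A j :=
  if @eqP _ i j is ReflectT e then ecast k (A k) e u else 0.

Lemma singlexx i (u : A i) : single u i = u.
Proof. by rewrite /single; case: eqP => // e; rewrite eq_axiomK. Qed.

Lemma single_neq i j (u : A i) : i != j -> single u j = 0.
Proof. by rewrite /single; case: eqP. Qed.

Lemma dinj_subproof i (u : A i) :
  exists s : seq I, forall j, j \notin s -> single u j = 0.
Proof.
by exists [:: i] => j; rewrite inE => ji; rewrite single_neq // eq_sym.
Qed.
Definition dinj i (u : A i) : dsum := DSum (dinj_subproof u).

Lemma coef_dinjxx i (u : A i) : dinj u i = u. Proof. exact: singlexx. Qed.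

Lemma coef_dinj_neq i j (u : A i) : i != j -> dinj u j = 0.
Proof. exact: single_neq. Qed.

Lemma dinj_is_zmod_morphism i : zmod_morphism (@dinj i).
Proof.
move=> u v; apply: dsum_ext => j; rewrite -[RHS]/(dinj u j - dinj v j).
have [<-|ij] := eqVneq i j; first by rewrite !coef_dinjxx.
by rewrite !coef_dinj_neq // subr0.
Qed.
HB.instance Definition _ i :=
  GRing.isZmodMorphism.Build (A i) dsum (@dinj i) (@dinj_is_zmod_morphism i).

Lemma dsum_decomp (x : dsum) (s : seq I) :
  uniq s -> (forall i, i \notin s -> x i = 0) -> x = \sum_(i <- s) dinj (x i).
Proof.
move=> us xs; apply: dsum_ext => i; rewrite -[RHS]/(coef i _) raddf_sum /=.
have [si|nsi] := boolP (i \in s).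
  rewrite (bigD1_seq i) //= /coef singlexx big1 ?addr0 // => j ji.
  exact: coef_dinj_neq.
rewrite (xs _ nsi) big_seq big1 // => j js; apply: coef_dinj_neq.
by apply: contraNneq nsi => <-.
Qed.

Definition in_supp (Q : pred I) (x : dsum) := forall i, ~~ Q i -> x i = 0.

Lemma in_supp0 Q : in_supp Q 0. Proof. by []. Qed.

Lemma in_suppD Q x y : in_supp Q x -> in_supp Q y -> in_supp Q (x + y).
Proof.
move=> Qx Qy i Qi; rewrite -[LHS]/(x i + y i).
by rewrite Qx // Qy // addr0.
Qed.

Lemma in_suppN Q x : in_supp Q x -> in_supp Q (- x).
Proof. by move=> Qx i Qi; rewrite -[LHS]/(- x i) Qx // oppr0. Qed.

Lemma in_suppB Q x y : in_supp Q x -> in_supp Q y -> in_supp Q (x - y).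
Proof. by move=> Qx Qy; apply: in_suppD => //; apply: in_suppN. Qed.

Lemma in_supp_sum Q (J : Type) (r : seq J) (R : pred J) (f : J -> dsum) :
  (forall j, R j -> in_supp Q (f j)) -> in_supp Q (\sum_(j <- r | R j) f j).
Proof.
by move=> Qf; apply: (big_ind (in_supp Q)) => //; exact: in_suppD.
Qed.

Lemma in_suppMz Q x (m : int) : in_supp Q x -> in_supp Q (x *~ m).
Proof. by move=> Qx i Qi; rewrite -[LHS]/(coef i _) raddfMz /= /coef Qx //
  mul0rz. Qed.

Lemma in_supp_dinj (Q : pred I) i (u : A i) : Q i -> in_supp Q (dinj u).
Proof. by move=> Qi j Qj; apply: coef_dinj_neq; apply: contraNneq Qj => <-. Qed.

Lemma sub_in_supp (Q Q' : pred I) x :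
  (forall i, Q i -> Q' i) -> in_supp Q x -> in_supp Q' x.
Proof. by move=> QQ' Qx i Qi; apply: Qx; apply: contraNN Qi; exact: QQ'. Qed.

Lemma in_suppI (Q Q' : pred I) x :
  in_supp Q x -> in_supp Q' x -> in_supp (fun i => Q i && Q' i) x.
Proof. by move=> Qx Qx' i; rewrite negb_and => /orP[/Qx|/Qx']. Qed.

Lemma in_supp_ind (Q : pred I) (K : dsum -> Prop) (x : dsum) :
  K 0 -> (forall y z, K y -> K z -> K (y + z)) ->
  (forall i u, Q i -> K (@dinj i u)) -> in_supp Q x -> K x.
Proof.
move=> K0 KD Kinj Qx; have [s xs] := dsumP x.
have xs' i : i \notin undup s -> x i = 0 by rewrite mem_undup; exact: xs.
rewrite (dsum_decomp (undup_uniq s) xs').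
apply: (big_ind K) => // i _; have [Qi|/Qx->] := boolP (Q i); first exact: Kinj.
by rewrite raddf0.
Qed.

Lemma dsum_ind (K : dsum -> Prop) (x : dsum) :
  K 0 -> (forall y z, K y -> K z -> K (y + z)) ->
  (forall i u, K (@dinj i u)) -> K x.
Proof. by move=> K0 KD Kinj; apply: (in_supp_ind (Q := predT) K0 KD) =>
  [i u _|]. Qed.

Lemma eq_additive_in (V : zmodType) (Q : pred I) (f g : {additive dsum ->
  V}) x :
  (forall i u, Q i -> f (@dinj i u) = g (dinj u)) -> in_supp Q x -> f x = g x.
Proof.
move=> fg; elim/in_supp_ind => [|y z fy fz|//]; first by rewrite !raddf0.
by rewrite !raddfD /= fy fz.
Qed.

Lemma eq_additive (V : zmodType) (f g : {additive dsum -> V}) :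
  (forall i u, f (@dinj i u) = g (dinj u)) -> f =1 g.
Proof. by move=> fg x; apply: (eq_additive_in (Q := predT)) => [i u _|]. Qed.

Section Lift.

Variables (V : zmodType) (T : forall i, A i -> V).
Hypothesis TD : forall i, {morph @T i : u v / u + v}.

(** The universal property of the direct sum. The support is picked by classical choice;
    [dlift_supp] shows that any duplicate-free list containing the support gives the same value. *)
Definition dlift of (forall i, {morph @T i : u v / u + v}) := fun x : dsum =>
  \sum_(i <- undup (sval (cid (dsumP x)))) T (x i).

Let T0 i : @T i 0 = 0.
Proof. by apply: (addrI (@T i 0)); rewrite -TD !addr0. Qed.

Lemma dlift_supp (x : dsum) (s : seq I) : uniq s -> (forall i, i \notin s ->
  x i = 0) ->
  dlift TD x = \sum_(i <- s) T (x i).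
Proof.
move=> us xs; rewrite /dlift; case: cid => t xt /=.
apply: eq_big_supp => // [||i _]; first exact: undup_uniq.
  by move=> i _ /xs->.
by rewrite mem_undup => /xt->.
Qed.

Lemma dlift_is_zmod_morphism : zmod_morphism (dlift TD).
Proof.
have LD : {morph dlift TD : x y / x + y}.
  move=> x y; have [s xs] := dsumP x; have [t yt] := dsumP y.
  have hx i : i \notin undup (s ++ t) -> x i = 0.
    by rewrite mem_undup mem_cat negb_or => /andP[/xs].
  have hy i : i \notin undup (s ++ t) -> y i = 0.
    by rewrite mem_undup mem_cat negb_or => /andP[_ /yt].
  have hxy i : i \notin undup (s ++ t) -> (x + y) i = 0.
    by move=> h; rewrite -[LHS]/(x i + y i) hx // hy // addr0.
  rewrite !(dlift_supp (undup_uniq (s ++ t))) // -big_split /=.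
  by apply: eq_bigr => i _; rewrite -TD.
have L0 : dlift TD 0 = 0 by apply: (addrI (dlift TD 0)); rewrite -LD !addr0.
move=> x y; rewrite LD; congr (_ + _); apply: (addrI (dlift TD y)).
by rewrite -LD !subrr L0.
Qed.
HB.instance Definition _ :=
  GRing.isZmodMorphism.Build dsum V (dlift TD) dlift_is_zmod_morphism.

Lemma dlift_dinj i (u : A i) : dlift TD (dinj u) = T u.
Proof.
rewrite (@dlift_supp _ [:: i]) ?big_seq1 ?coef_dinjxx // => j.
by rewrite inE => ji; rewrite coef_dinj_neq // eq_sym.
Qed.

End Lift.

(** By additivity it is enough to know, through a relation [S], which indices occur in the image of
    a generator. Most bounds on degrees below are obtained from such relations. *)
Lemma in_supp_additive (f : {additive dsum -> dsum}) (S : I -> pred I)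
    (Q Q' : pred I) x :
  (forall i u, in_supp (S i) (f (@dinj i u))) ->
  (forall i j, Q i -> S i j -> Q' j) -> in_supp Q x -> in_supp Q' (f x).
Proof.
move=> fS SQ; elim/in_supp_ind => [|y z fy fz|i u Qi].
- by rewrite raddf0.
- by rewrite raddfD; apply: in_suppD.
- by apply: sub_in_supp (fS i u) => j; apply: SQ.
Qed.

Lemma dg_subproof (c : I -> int) (i : I) :
  {morph (fun u : A i => dinj (u *~ c i)) : u v / u + v}.
Proof. by move=> u v; rewrite mulrzDl raddfD. Qed.

(** The diagonal operator with integer eigenvalues [c i]. Signs and projections onto parts of the
    index set are of this form. *)
Definition dg (c : I -> int) : dsum -> dsum := dlift (dg_subproof c).
HB.instance Definition _ c := GRing.Additive.copy (dg c) (dlift (dg_subproof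
  c)).

Lemma dgE c i (u : A i) : dg c (dinj u) = dinj u *~ c i.
Proof. by rewrite /dg dlift_dinj raddfMz. Qed.

Lemma coef_dg c (x : dsum) i : dg c x i = x i *~ c i.
Proof.
apply: (@dsum_ind (fun x => dg c x i = x i *~ c i)).
- by rewrite raddf0 mul0rz.
- move=> y z hy hz; rewrite raddfD -[LHS]/(dg c y i + dg c z i).
  by rewrite -[(y + z) i]/(y i + z i) hy hz mulrzDl.
move=> j u; rewrite dgE -[LHS]/(coef i _) raddfMz /= /coef.
have [e|ji] := eqVneq j i; first by subst i.
by rewrite [single _ _]coef_dinj_neq // !mul0rz.
Qed.

Lemma in_supp_dg Q c x : in_supp Q x -> in_supp Q (dg c x).
Proof. by move=> Qx i Qi; rewrite coef_dg Qx // mul0rz. Qed.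

Lemma dg_dg c c' x : dg c (dg c' x) = dg (fun i => c i * c' i) x.
Proof. by apply: dsum_ext => i; rewrite !coef_dg -mulrzA mulrC. Qed.

Lemma eq_dg c c' x : c =1 c' -> dg c x = dg c' x.
Proof. by move=> cc'; apply: dsum_ext => i; rewrite !coef_dg cc'. Qed.

Lemma dgN c x : dg (fun i => - c i) x = - dg c x.
Proof.
by apply: dsum_ext => i; rewrite -[RHS]/(- dg c x i) !coef_dg mulrNz.
Qed.

Lemma dg_const_in (Q : pred I) c (m : int) x :
  (forall i, Q i -> c i = m) -> in_supp Q x -> dg c x = x *~ m.
Proof.
move=> cm Qx; apply: dsum_ext => i; rewrite coef_dg -[RHS]/(coef i _) raddfMz.
rewrite /= /coef.
by have [/cm->//|/Qx->] := boolP (Q i); rewrite !mul0rz.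
Qed.

Lemma dg_additive (f : {additive dsum -> dsum}) (S : I -> pred I) c c' x :
  (forall i u, in_supp (S i) (f (@dinj i u))) ->
  (forall i j, S i j -> c j = c' i) -> dg c (f x) = f (dg c' x).
Proof.
move=> fS Sc; apply: (eq_additive (f := dg c \o f) (g := f \o dg c')) => i u /=.
by rewrite dgE raddfMz; apply: (dg_const_in (Q := S i)) => // j; apply: Sc.
Qed.

Lemma dg0 x : dg (fun=> 0) x = 0.
Proof. by apply: dsum_ext => i; rewrite coef_dg. Qed.

Lemma dg1 x : dg (fun=> 1) x = x.
Proof. by apply: dsum_ext => i; rewrite coef_dg. Qed.

End DirectSum.

Arguments dg {I A} c.

(** * Vectors of exponents and the action of [F] on factorizations *)

Section Complexes.

Variables (n : nat) (F : natsys n).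

Local Notation vec := {ffun 'I_n -> nat}.
Local Notation ix := (vec * seq (P n))%type.
Local Notation Fix := (fun i : ix => Fob F i.1).
Local Notation U := (dsum Fix).

Lemma vecP (a b : vec) : (forall i : 'I_n, a i = b i) -> a = b.
Proof. by move=> ab; apply/ffunP => i; exact: ab. Qed.

Lemma eq_vec (a b : vec) : a = b -> forall i : 'I_n, a i = b i.
Proof. by move->. Qed.

Lemma vaddE (a b : vec) i : vadd a b i = (a i + b i)%N.
Proof. by rewrite ffunE. Qed.

Lemma vsubE (a b : vec) i : vsub a b i = (a i - b i)%N.
Proof. by rewrite ffunE. Qed.

Lemma v0E i : v0 n i = 0%N.
Proof. by rewrite ffunE. Qed.

Lemma genE i j : @gen n i j = (j == i) :> nat.
Proof. by rewrite ffunE. Qed.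

Definition weight (a : P n) : vec := vadd a.1 a.2.

Lemma weightE a i : weight a i = (a.1 i + a.2 i)%N.
Proof. by rewrite ffunE. Qed.

Definition vE := (vaddE, vsubE, v0E, genE, weightE).

Lemma vleP (a b : vec) : reflect (forall i, (a i <= b i)%N) (vle a b).
Proof. exact: forallP. Qed.

Lemma FmE al be f g (e : vadd (vadd g al) f = be) u :
  Fm F al be f g u = Fmor F al be f g e u.
Proof. by rewrite /Fm; case: eqP => // e'; rewrite (Prop_irrelevance e' e). Qed.

Lemma Fm_neq al be f g u : vadd (vadd g al) f != be -> Fm F al be f g u = 0.
Proof. by rewrite /Fm; case: eqP. Qed.

Lemma FmD al be f g : {morph Fm F al be f g : u v / u + v}.
Proof.
move=> u v; rewrite /Fm; case: eqP => [e|_]; first exact: Fmor_add.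
by rewrite addr0.
Qed.

Lemma Fm0 al be f g : Fm F al be f g 0 = 0.
Proof. by apply: (addrI (Fm F al be f g 0)); rewrite -FmD !addr0. Qed.

Lemma Fm_id al u : Fm F al al (v0 n) (v0 n) u = u.
Proof.
have e : vadd (vadd (v0 n) al) (v0 n) = al.
  by apply/vecP => i; rewrite !vE; lia.
by rewrite (FmE e) Fmor_id.
Qed.

(* Composite in the factorization category of [a], then [b]. *)
Definition pcomp (b a : P n) : P n := (vadd a.1 b.1, vadd b.2 a.2).

(** If one of the truncated subtractions does not give a true factorization, both sides are the
    default value 0 of [Fm]. This keeps the identities for [act] below free of side conditions. *)
Lemma Fm_comp al (a b : P n) u :
  Fm F (vsub (vsub al (weight b)) (weight a)) (vsub al (weight b)) a.1 a.2
     (Fm F (vsub al (weight b)) al b.1 b.2 u) =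
  Fm F (vsub (vsub al (weight b)) (weight a)) al (pcomp b a).1 (pcomp b a).2 u.
Proof.
set be := vsub al (weight b); set ga := vsub be _.
have [eb|nb] := eqVneq (vadd (vadd b.2 be) b.1) al; last first.
  rewrite (Fm_neq _ nb) Fm0 Fm_neq //; apply: contra_neq nb => e.
  apply/vecP => i; move/eq_vec/(_ i): e; rewrite /ga /be /= !vE; lia.
have [ea|na] := eqVneq (vadd (vadd a.2 ga) a.1) be; last first.
  rewrite (Fm_neq _ na) Fm_neq //; apply: contra_neq na => e.
  apply/vecP => i; move/eq_vec/(_ i): e; rewrite /ga /be /= !vE; lia.
have eab : vadd (vadd (pcomp b a).2 ga) (pcomp b a).1 = al.
  apply/vecP => i; move/eq_vec/(_ i): ea; move/eq_vec/(_ i): eb.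
  rewrite /ga /be /= !vE; lia.
by rewrite (FmE eb) (FmE ea) (FmE eab); apply/esym/Fmor_comp.
Qed.

(** * Chains with a prescribed last object *)

(* An index [(al, r)] stands for the chain that starts at [al] and runs
   through [rev r]: the head of [r] is the last morphism of the chain. *)
Definition gn al (r : seq (P n)) (u : F al) : U := @dinj _ Fix (al, r) u.

Lemma gnD al r : {morph gn (al := al) r : u v / u + v}.
Proof. by move=> u v; rewrite /gn raddfD. Qed.

Lemma gnE (i : ix) (u : F i.1) : @dinj _ Fix i u = gn i.2 u.
Proof. by case: i u. Qed.

Lemma eq_on_gn (f g : {additive U -> U}) :
  (forall al r u, f (@gn al r u) = g (gn r u)) -> f =1 g.
Proof. by move=> fg; apply: eq_additive => -[al r] u; exact: fg. Qed.

Fixpoint tot (r : seq (P n)) : vec :=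
  if r is a :: r' then vadd (weight a) (tot r') else v0 n.

(** The last object of the chain. The subtraction is truncated, so this is the intended object only
    under [validr]. *)
Definition endv (i : ix) : vec := vsub i.1 (tot i.2).

Definition validr (i : ix) : bool := vle (tot i.2) i.1.

Lemma endv_cons al a r : endv (al, a :: r) = vsub (endv (al, r)) (weight a).
Proof. by apply/vecP => i; rewrite /endv /= !vE /= ?vE; lia. Qed.

Lemma endv_nil al : endv (al, [::]) = al.
Proof. by apply/vecP => i; rewrite /endv /= !vE /= ?vE; lia. Qed.

Lemma validr_nil al : validr (al, [::]).
Proof. by apply/vleP => i; rewrite !vE. Qed.

Lemma validr_cons al a r :
  validr (al, a :: r) = validr (al, r) && vle (weight a) (endv (al, r)).
Proof.
apply/vleP/andP => /= [h|[/vleP h /vleP h'] i].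
  by split; apply/vleP => i; move: (h i); rewrite /endv /= !vE /= ?vE; lia.
by move: (h i) (h' i); rewrite /endv /= !vE /= ?vE; lia.
Qed.

Definition pid : P n := (v0 n, v0 n).

Definition appendg a (i : ix) (u : F i.1) : U := gn (a :: i.2) u.
Lemma appendgD a i : {morph @appendg a i : u v / u + v}.
Proof. exact: gnD. Qed.
Definition append a : U -> U := dlift (appendgD a).
HB.instance Definition _ a := GRing.Additive.copy (append a) (dlift (appendgD
  a)).

Lemma appendE a al r (u : F al) : append a (gn r u) = gn (a :: r) u.
Proof. exact: dlift_dinj. Qed.

Definition drop_lastg (i : ix) (u : F i.1) : U :=
  if i.2 is _ :: r then gn r u else 0.
Lemma drop_lastgD i : {morph @drop_lastg i : u v / u + v}.
Proof.
move=> u v; rewrite /drop_lastg; case: i.2 => [|_ r]; first by rewrite addr0.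
exact: gnD.
Qed.
Definition drop_last : U -> U := dlift drop_lastgD.
HB.instance Definition _ := GRing.Additive.copy drop_last (dlift drop_lastgD).

Lemma drop_last_nil al (u : F al) : drop_last (gn [::] u) = 0.
Proof. exact: dlift_dinj. Qed.

Lemma drop_last_cons al a r (u : F al) : drop_last (gn (a :: r) u) = gn r u.
Proof. exact: dlift_dinj. Qed.

(** Precomposition of the last morphism of the chain with [a]. On the chain of length 0 the map
    induced by [a] on [F] is applied to the coefficient instead, so that face 0 needs no case of its
    own in [hg]. *)
Definition actg a (i : ix) (u : F i.1) : U :=
  if i.2 is b :: r then gn (pcomp b a :: r) u
  else gn [::] (Fm F (vsub i.1 (weight a)) i.1 a.1 a.2 u).
Lemma actgD a i : {morph @actg a i : u v / u + v}.
Proof.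
move=> u v; rewrite /actg; case: i.2 => [|b r]; last exact: gnD.
by rewrite FmD gnD.
Qed.
Definition act a : U -> U := dlift (actgD a).
HB.instance Definition _ a := GRing.Additive.copy (act a) (dlift (actgD a)).

Lemma act_nil a al (u : F al) :
  act a (gn [::] u) = gn [::] (Fm F (vsub al (weight a)) al a.1 a.2 u).
Proof. exact: dlift_dinj. Qed.

Lemma act_cons a al b r (u : F al) :
  act a (gn (b :: r) u) = gn (pcomp b a :: r) u.
Proof. exact: dlift_dinj. Qed.

Lemma weight_pcomp b a : weight (pcomp b a) = vadd (weight b) (weight a).
Proof. by apply/vecP => i; rewrite /= !vE /= ?vE; lia. Qed.

Lemma vsub_vadd (x a b : vec) : vsub x (vadd a b) = vsub (vsub x a) b.
Proof. by apply/vecP => i; rewrite /= !vE /= ?vE; lia. Qed.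

Lemma act_act a b x : act a (act b x) = act (pcomp b a) x.
Proof.
pose f := (act a \o act b : {additive U -> U}).
apply: (eq_on_gn (f := f) (g := act (pcomp b a))) => al [|c r] u; rewrite /f /=.
  by rewrite !act_nil Fm_comp /= weight_pcomp vsub_vadd.
rewrite !act_cons; congr (gn (_ :: _) _).
by congr (_, _); apply/vecP => i; rewrite /= !vE; lia.
Qed.

Lemma act_id x : act pid x = x.
Proof.
apply: (eq_on_gn (f := act pid) (g := idfun)) => al [|c r] u /=.
  rewrite act_nil /=.
  have -> : vsub al (weight pid) = al.
    by apply/vecP => i; rewrite /= !vE /= ?vE; lia.
  by rewrite Fm_id.
rewrite act_cons; congr (gn (_ :: _) _); rewrite [RHS]surjective_pairing.
by congr (_, _); apply/vecP => i; rewrite /= !vE; lia.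
Qed.

Lemma act_append a b x : act a (append b x) = append (pcomp b a) x.
Proof.
apply: (eq_on_gn (f := act a \o append b) (g := append (pcomp b a))) =>
  al r u /=.
by rewrite !appendE act_cons.
Qed.

Lemma drop_last_append a x : drop_last (append a x) = x.
Proof.
apply: (eq_on_gn (f := drop_last \o append a) (g := idfun)) => al r u /=.
by rewrite appendE drop_last_cons.
Qed.

Lemma drop_last_act a x : drop_last (act a x) = drop_last x.
Proof.
apply: (eq_on_gn (f := drop_last \o act a) (g := drop_last)) => al [|b r] u /=.
  by rewrite act_nil !drop_last_nil.
by rewrite act_cons !drop_last_cons.
Qed.

(** * Signs, the differential of the rows and the Leech differential *)

Definition sg (m : nat) : int := (-1) ^+ m.

Lemma sgS m : sg m.+1 = - sg m. Proof. by rewrite /sg exprS mulN1r. Qed.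

Lemma sg_sq m : sg m * sg m = 1.
Proof. by rewrite -exprD addnn -mul2n exprM sqrrN expr1n. Qed.

Definition parity : U -> U := dg (fun i : ix => sg (size i.2)).
HB.instance Definition _ := GRing.Additive.copy parity (dg (fun i : ix =>
  sg (size i.2))).

Lemma parityE al r (u : F al) : parity (gn r u) = gn r u *~ sg (size r).
Proof. exact: dgE. Qed.

Lemma parityK x : parity (parity x) = x.
Proof.
rewrite /parity dg_dg (@eq_dg _ _ _ (fun=> 1)) ?dg1 // => i.
exact: sg_sq.
Qed.

Lemma parity_append a x : parity (append a x) = - append a (parity x).
Proof.
apply: (eq_on_gn (f := parity \o append a) (g :=
  -%R \o (append a \o parity))) => al r u /=.
by rewrite parityE raddfMz /= !appendE parityE /= sgS mulrNz.
Qed.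

Lemma parity_act a x : parity (act a x) = act a (parity x).
Proof.
apply: (eq_on_gn (f := parity \o act a) (g := act a \o parity)) =>
  al [|b r] u /=.
  by rewrite parityE raddfMz /= !act_nil parityE.
by rewrite parityE raddfMz /= !act_cons parityE.
Qed.

(* All faces but the last one. They keep the last morphism [a] of the chain,
   except the penultimate face, where [a] acts on the end of the shorter chain. *)
Fixpoint hg al (r : seq (P n)) (u : F al) : U :=
  if r is a :: r' then append a (hg r' u) + act a (gn r' u) *~ sg (size r')
    else 0.
Lemma hgD (i : ix) : {morph @hg i.1 i.2 : u v / u + v}.
Proof.
move=> u v; elim: i.2 => [|a r IHr] /=; first by rewrite addr0.
by rewrite IHr gnD !raddfD /= mulrzDl addrACA.
Qed.
Definition hdiff : U -> U := dlift hgD.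
HB.instance Definition _ := GRing.Additive.copy hdiff (dlift hgD).

Lemma hdiffE al r (u : F al) : hdiff (gn r u) = hg r u.
Proof. exact: dlift_dinj. Qed.

Lemma hdiff_nil al (u : F al) : hdiff (gn [::] u) = 0.
Proof. by rewrite hdiffE. Qed.

Lemma hdiff_append a x : hdiff (append a x) = append a (hdiff x) + act a
  (parity x).
Proof.
apply: (eq_on_gn (f := hdiff \o append a) (g :=
  (append a \o hdiff) \+ (act a \o parity))).
by move=> al r u /=; rewrite appendE !hdiffE parityE raddfMz.
Qed.

Lemma hdiff_cons al a r (u : F al) :
  hdiff (gn (a :: r) u) = append a (hdiff (gn r u)) + act a (gn r u) *~ sg
    (size r).
Proof. by rewrite !hdiffE. Qed.

Lemma hdiff_act a x : hdiff (act a x) = act a (hdiff x).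
Proof.
apply: (eq_on_gn (f := hdiff \o act a) (g := act a \o hdiff)) => al [|b r] u /=.
  by rewrite act_nil !hdiff_nil raddf0.
by rewrite act_cons !hdiff_cons raddfD raddfMz /= act_append act_act.
Qed.

Lemma parity_hdiff x : parity (hdiff x) = - hdiff (parity x).
Proof.
apply: (eq_on_gn (f := parity \o hdiff) (g := -%R \o (hdiff \o parity))) =>
  al r u /=.
elim: r => [|a r IHr]; first by rewrite parityE raddfMz /= hdiff_nil raddf0
  mul0rz oppr0.
rewrite -appendE hdiff_append raddfD /= !parity_append parity_act parityK IHr.
by rewrite !raddfN !opprK /= hdiff_append parityK.
Qed.

(** In the recursion along [append a] the cross terms are [act a] applied to
    [parity (hdiff x) + hdiff (parity x)], which vanishes. *)
Lemma hdiff_hdiff x : hdiff (hdiff x) = 0.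
Proof.
apply: (eq_on_gn (f := hdiff \o hdiff) (g := \0)) => al r u /=.
elim: r => [|a r IHr]; first by rewrite hdiff_nil raddf0.
by rewrite -appendE hdiff_append raddfD /= hdiff_append IHr raddf0 add0r
  hdiff_act parity_hdiff raddfN addNr.
Qed.

(** The identity is appended at the end whose face [hdiff] omits. The only new face composes it with
    the previous morphism and returns the chain, which makes this a contraction. *)
Definition extra_deg : U -> U := append pid \o parity.
HB.instance Definition _ := GRing.Additive.copy extra_deg (append pid \o
  parity).

Lemma hdiff_extra_deg x : hdiff (extra_deg x) + extra_deg (hdiff x) = x.
Proof.
by rewrite /extra_deg /= hdiff_append parityK act_id parity_hdiff raddfN addrAC
  subrr add0r.
Qed.

Definition leech_diff : U -> U := hdiff \+ (drop_last \o parity).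
HB.instance Definition _ := GRing.Additive.copy leech_diff (hdiff \+ (drop_last
  \o parity)).

(** On a chain [a :: r] the faces that keep [a] become the faces of [r] counted by [hdiff], and the
    face in which [a] acts becomes the last face of [r], with the sign it has in [leech_diff]. *)
Lemma drop_last_hdiff x : drop_last (hdiff x) = leech_diff (drop_last x).
Proof.
apply: (eq_on_gn (f := drop_last \o hdiff) (g := leech_diff \o drop_last)) =>
  al [|a r] u /=.
  by rewrite hdiff_nil drop_last_nil !raddf0.
by rewrite hdiff_cons raddfD raddfMz /= drop_last_append drop_last_cons
  drop_last_act /leech_diff /= parityE raddfMz.
Qed.

(** * Supports of the operators and weights depending on the last object *)

Definition rel_shift (w : vec) (i j : ix) :=
  [&& endv j == vsub (endv i) w, size j.2 == size i.2 &
      validr i && vle w (endv i) ==> validr j].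

Lemma act_supp a i (u : Fix i) : in_supp (rel_shift (weight a) i) (act a (dinj
  u)).
Proof.
case: i u => al [|b r] u; rewrite gnE ?act_nil ?act_cons; apply: in_supp_dinj.
  by rewrite /rel_shift !endv_nil !eqxx !validr_nil implybT.
rewrite /rel_shift !endv_cons weight_pcomp vsub_vadd !eqxx /= !validr_cons.
apply/implyP => /andP[/andP[-> /vleP h1] /vleP h2]; apply/vleP => k.
by move: (h1 k) (h2 k); rewrite weight_pcomp !vE; lia.
Qed.

Lemma append_supp a i (u : Fix i) : in_supp (pred1 (i.1, a :: i.2)) (append a
  (dinj u)).
Proof.
by case: i u => al r u; rewrite gnE appendE; apply: in_supp_dinj => /=.
Qed.

Definition rel_face (i j : ix) :=
  [&& endv j == endv i, (size j.2).+1 == size i.2 & validr i ==> validr j].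

Lemma hdiff_supp i (u : Fix i) : in_supp (rel_face i) (hdiff (dinj u)).
Proof.
case: i u => al r /= u; rewrite gnE /=; elim: r => [|a r IHr].
  by rewrite hdiff_nil; exact: in_supp0.
rewrite hdiff_cons; apply: in_suppD.
  apply: (in_supp_additive _ _ IHr); first exact: append_supp.
  move=> [al' r'] k; rewrite /rel_face /= => /and3P[/eqP e /eqP s v] /eqP->.
  rewrite !endv_cons e eqxx /= -s eqxx /= !validr_cons e.
  by apply/implyP => /andP[h ->]; rewrite (implyP v).
apply: in_suppMz; apply: sub_in_supp (@act_supp a (al, r) u) => -[al' r'].
rewrite /rel_shift /rel_face /= => /and3P[/eqP e /eqP -> v].
by rewrite e endv_cons !eqxx /= validr_cons.
Qed.

Definition dg_end (phi : vec -> int) : U -> U := dg (phi \o endv).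
HB.instance Definition _ phi := GRing.Additive.copy (dg_end phi) (dg (phi \o
  endv)).

Lemma dg_endE phi al r (u : F al) : dg_end phi (gn r u) = gn r u *~ phi (endv
  (al, r)).
Proof. exact: dgE. Qed.

Lemma dg_end_act phi a x :
  dg_end phi (act a x) = act a (dg_end (fun e => phi (vsub e (weight a))) x).
Proof.
apply: dg_additive; first exact: act_supp.
by move=> i j /and3P[/eqP e _ _] /=; rewrite e.
Qed.

Lemma dg_end_hdiff phi x : dg_end phi (hdiff x) = hdiff (dg_end phi x).
Proof.
apply: dg_additive; first exact: hdiff_supp.
by move=> i j /and3P[/eqP e _ _] /=; rewrite e.
Qed.

Lemma dg_end_parity phi x : dg_end phi (parity x) = parity (dg_end phi x).
Proof. by rewrite /dg_end /parity !dg_dg; apply: eq_dg => i; rewrite mulrC. Qed.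

Lemma dg_end_dg_end phi psi x : dg_end phi (dg_end psi x) = dg_end (fun e =>
  phi e * psi e) x.
Proof. exact: dg_dg. Qed.

Lemma eq_dg_end phi psi x : phi =1 psi -> dg_end phi x = dg_end psi x.
Proof. by move=> e; apply: eq_dg => i; exact: e. Qed.

(** * The Koszul direction *)

Definition diff (i : 'I_n) : U -> U := act (v0 n, gen i) \- act (gen i, v0 n).
HB.instance Definition _ i :=
  GRing.Additive.copy (diff i) (act (v0 n, gen i) \- act (gen i, v0 n)).

Lemma weight0g (i : 'I_n) : weight (v0 n, gen i) = gen i.
Proof. by apply: vecP => k; rewrite !vE. Qed.

Lemma weightg0 (i : 'I_n) : weight (gen i, v0 n) = gen i.
Proof. by apply: vecP => k; rewrite !vE addn0. Qed.

Lemma diff_supp k i (u : Fix i) : in_supp (rel_shift (gen k) i) (diff k (dinj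
  u)).
Proof.
apply: in_suppB.
  by have := @act_supp (v0 n, gen k) i u; rewrite weight0g.
by have := @act_supp (gen k, v0 n) i u; rewrite weightg0.
Qed.

Lemma act_actC a b x : act a (act b x) = act b (act a x).
Proof.
rewrite !act_act; congr (act (_, _) _); apply: vecP => i; rewrite !vE; lia.
Qed.

Lemma diffC i j x : diff i (diff j x) = diff j (diff i x).
Proof.
rewrite /diff /= !(raddfB (act _)) /=.
rewrite !(act_actC (v0 n, gen j)) !(act_actC (gen j, v0 n)).
by rewrite [in LHS]opprB [in RHS]opprB addrACA [RHS]addrACA [in RHS](addrC (-
  _)).
Qed.

Lemma hdiff_diff i x : hdiff (diff i x) = diff i (hdiff x).
Proof. by rewrite /diff /= raddfB /= !hdiff_act. Qed.

Lemma parity_diff i x : parity (diff i x) = diff i (parity x).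
Proof. by rewrite /diff /= raddfB /= !parity_act. Qed.

Lemma drop_last_diff i x : drop_last (diff i x) = 0.
Proof. by rewrite /diff /= raddfB /= !drop_last_act subrr. Qed.

Lemma dg_end_diff phi i x :
  dg_end phi (diff i x) = diff i (dg_end (fun e => phi (vsub e (gen i))) x).
Proof. by rewrite /diff /= raddfB /= !dg_end_act weight0g weightg0. Qed.

Definition cnt (i : 'I_n) (e : vec) : nat :=
  #|[pred j : 'I_n | (j < i)%N && (e j == 1%N)]|.

Lemma cnt_vsub (i j : 'I_n) (e : vec) :
  e j = 1%N -> cnt i e = ((j < i) + cnt i (vsub e (gen j)))%N.
Proof.
move=> ej; rewrite /cnt (cardD1 j) inE ej eqxx andbT; congr (_ + _)%N.
apply: eq_card => k; rewrite !inE !vE; have [->|kj] := eqVneq k j.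
  by rewrite ej subnn andbF.
by rewrite subn0.
Qed.

(** The Koszul sign for removing the direction [i] from the cube [e]: if [i] is its [s]-th
    direction, the value is [- (-1)^s]. It is 0 if [i] is not a direction. *)
Definition chi (i : 'I_n) (e : vec) : int :=
  if e i == 1%N then sg (cnt i e) else 0.

(** Of two distinct directions, removing the smaller one shifts the position of the larger, while
    removing the larger one leaves that of the smaller. *)
Lemma chi_asym (i j : 'I_n) e :
  chi i (vsub e (gen j)) * chi j e = - (chi j (vsub e (gen i)) * chi i e).
Proof.
rewrite /chi !vE; have [->|ij] := eqVneq i j.
  case: (e j =P 1%N) => [->|]; last by rewrite !mulr0 oppr0.
  by rewrite subnn !mul0r oppr0.
rewrite !subn0.
case: (e j =P 1%N) => [ej|]; last by rewrite mulr0 mul0r oppr0.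
case: (e i =P 1%N) => [ei|]; last by rewrite mulr0 mul0r oppr0.
rewrite (cnt_vsub i ej) (cnt_vsub j ei).
have [lt|gt|/val_inj e'] := ltngtP i j; last by rewrite e' eqxx in ij.
  by rewrite add0n add1n sgS mulrN mulrC.
by rewrite add0n add1n sgS mulrN opprK mulrC.
Qed.

Lemma chi_idem i e : chi i (vsub e (gen i)) * chi i e = 0.
Proof.
rewrite /chi !vE eqxx; case: (e i =P 1%N) => [->|]; last by rewrite mulr0.
by rewrite subnn mul0r.
Qed.

(** Terms below and above the diagonal cancel. The diagonal has a hypothesis of its own because [V]
    may have 2-torsion. *)
Lemma sum_antisym (V : zmodType) (G : 'I_n -> 'I_n -> V) :
  (forall i, G i i = 0) -> (forall i j, G i j = - G j i) ->
  \sum_i \sum_j G i j = 0.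
Proof.
move=> G0 GN; transitivity
  (\sum_(i < n) (\sum_(j < n | (j < i)%N) G i j + \sum_(j < n | (i < j)%N) G i
    j)).
  apply: eq_bigr => i _; rewrite (bigID (fun j : 'I_n => (j < i)%N)) /=.
  congr (_ + _); rewrite (bigD1 i) ?ltnn //= G0 add0r; apply: eq_bigl => j.
  by rewrite -leqNgt ltn_neqAle andbC [i == j :> nat]eq_sym.
rewrite big_split /= [X in _ + X](exchange_big_dep predT) //= -big_split /=.
rewrite big1 // => i _; rewrite -big_split /= big1 // => j _.
by rewrite GN addNr.
Qed.

(** The minus sign turns [chi] into the sign [(-1)^s] of the cubical differential; [parity] makes
    the operator anticommute with [hdiff]. *)
Definition vdiff : U -> U := fun x => - \sum_i diff i (dg_end (chi i) (parity
  x)).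
Lemma vdiff_is_zmod_morphism : zmod_morphism vdiff.
Proof.
move=> x y; rewrite /vdiff -opprD; congr (- _).
by rewrite -sumrB; apply: eq_bigr => i _; rewrite !raddfB.
Qed.
HB.instance Definition _ := GRing.isZmodMorphism.Build U U vdiff
  vdiff_is_zmod_morphism.

Lemma hdiff_vdiff x : hdiff (vdiff x) = - vdiff (hdiff x).
Proof.
rewrite /vdiff opprK (raddfN hdiff) (raddf_sum hdiff) -sumrN; apply: eq_bigr =>
  i _ /=.
by rewrite hdiff_diff -dg_end_hdiff parity_hdiff !raddfN.
Qed.

Lemma vdiff_vdiff x : vdiff (vdiff x) = 0.
Proof.
(* The two parities cancel, and the weight of the outer [diff i] is moved inside [diff j], where it
   is evaluated at the cube without the direction [j]. *)
transitivity (\sum_i \sum_j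
    diff i (diff j (dg_end (fun e => chi i (vsub e (gen j)) * chi j e) x))).
  rewrite {1}/vdiff -sumrN; apply: eq_bigr => i _;
    rewrite /vdiff (raddfN parity).
  rewrite (raddfN (dg_end _)) (raddfN (diff i)) opprK (raddf_sum parity).
  rewrite (raddf_sum (dg_end _)) (raddf_sum (diff i)); apply: eq_bigr => j _ /=.
  by rewrite parity_diff -dg_end_parity parityK dg_end_diff dg_end_dg_end.
apply: sum_antisym => [i|i j].
  rewrite (@eq_dg_end _ (fun=> 0)); last by move=> e; exact: chi_idem.
  by rewrite /dg_end dg0 !raddf0.
rewrite [LHS]diffC -(raddfN (diff j)) -(raddfN (diff i));
  congr (diff _ (diff _ _)).
rewrite /dg_end -dgN; apply: eq_dg => e; exact: chi_asym.
Qed.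

(** * The total complex and its augmentation *)

Definition tdiff : U -> U := hdiff \+ vdiff.
HB.instance Definition _ := GRing.Additive.copy tdiff (hdiff \+ vdiff).

Lemma tdiff_tdiff x : tdiff (tdiff x) = 0.
Proof.
rewrite /tdiff /= !raddfD /= hdiff_hdiff vdiff_vdiff add0r addr0 hdiff_vdiff.
by rewrite addrC subrr.
Qed.

Definition isz (e : vec) : int := if e == v0 n then 1 else 0.

Definition augm : U -> U := drop_last \o dg_end isz.
HB.instance Definition _ := GRing.Additive.copy augm (drop_last \o dg_end isz).

(** The two terms of [diff i] differ only in the last morphism, which [drop_last] forgets. *)
Lemma augm_vdiff x : augm (vdiff x) = 0.
Proof.
rewrite /augm /= /vdiff (raddfN (dg_end _)) (raddfN drop_last) (raddf_sum
  (dg_end _)).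
rewrite (raddf_sum drop_last) big1 ?oppr0 // => i _ /=.
by rewrite dg_end_diff drop_last_diff.
Qed.

Lemma augm_tdiff x : augm (tdiff x) = leech_diff (augm x).
Proof. by rewrite /tdiff raddfD /= augm_vdiff addr0 /augm /= dg_end_hdiff
  drop_last_hdiff. Qed.

Definition rel_vdiff (i j : ix) :=
  [exists k, [&& endv i k == 1%N, endv j == vsub (endv i) (gen k),
                 size j.2 == size i.2 & validr i ==> validr j]].

Lemma vdiff_supp i (u : Fix i) : in_supp (rel_vdiff i) (vdiff (dinj u)).
Proof.
case: i u => al r /= u; apply: in_suppN; apply: in_supp_sum => k _.
rewrite gnE parityE (raddfMz (dg_end _)) /= dg_endE !(raddfMz (diff k));
  apply: in_suppMz; rewrite /chi.
case: eqP => [ek|_]; last exact: in_supp0.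
apply: in_suppMz; apply: sub_in_supp (@diff_supp k (al, r) u) => j.
move=> /and3P[/eqP e /eqP s v]; apply/existsP; exists k.
rewrite ek e s !eqxx /=; apply/implyP => h; apply: (implyP v).
by rewrite h; apply/vleP => l; rewrite genE; case: eqVneq => [->|//];
  rewrite ek.
Qed.

(** * Contraction of the columns, one coordinate at a time *)

Definition move (i : 'I_n) (s t : nat) (c : P n) : P n :=
  ([ffun j => (c.1 j + (j == i) * s)%N], [ffun j => (c.2 j - (j == i) * t)%N]).

Arguments move : simpl never.

Lemma move1E i s t c j : (move i s t c).1 j = (c.1 j + (j == i) * s)%N.
Proof. by rewrite ffunE. Qed.

Lemma move2E i s t c j : (move i s t c).2 j = (c.2 j - (j == i) * t)%N.
Proof. by rewrite ffunE. Qed.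

Lemma pairP (c d : P n) :
  (forall i, c.1 i = d.1 i) -> (forall i, c.2 i = d.2 i) -> c = d.
Proof. by case: c d => [f g] [f' g'] /= /vecP-> /vecP->. Qed.

Lemma pcomp1E b a j : (pcomp b a).1 j = (a.1 j + b.1 j)%N.
Proof. exact: vaddE. Qed.

Lemma pcomp2E b a j : (pcomp b a).2 j = (b.2 j + a.2 j)%N.
Proof. exact: vaddE. Qed.

Definition pE := (pcomp1E, pcomp2E, move1E, move2E).

(* The contraction, in coordinate [k], of the complex with differential
   [d (f, g) = (f, g + 1) - (f + 1, g)]. *)
Definition slideg (k : 'I_n) (i : ix) (u : F i.1) : U :=
  if i.2 is c :: r then \sum_(t < c.2 k) gn (move k t t.+1 c :: r) u else 0.
Lemma slidegD k i : {morph @slideg k i : u v / u + v}.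
Proof.
move=> u v; rewrite /slideg; case: i.2 => [|c r]; first by rewrite addr0.
by rewrite -big_split; apply: eq_bigr => t _; exact: gnD.
Qed.
Definition slide k : U -> U := dlift (slidegD k).
HB.instance Definition _ k := GRing.Additive.copy (slide k) (dlift (slidegD k)).

Lemma slide_nil k al (u : F al) : slide k (gn [::] u) = 0.
Proof. exact: dlift_dinj. Qed.

Lemma slide_cons k al c r (u : F al) :
  slide k (gn (c :: r) u) = \sum_(t < c.2 k) gn (move k t t.+1 c :: r) u.
Proof. exact: dlift_dinj. Qed.

Lemma parity_slide k x : parity (slide k x) = slide k (parity x).
Proof.
apply: (eq_on_gn (f := parity \o slide k) (g := slide k \o parity)) =>
  al [|c r] u /=.
  by rewrite parityE raddfMz /= slide_nil raddf0 mul0rz.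
rewrite parityE raddfMz /= slide_cons raddf_sum mulrz_suml.
by apply: eq_bigr => t _ /=; rewrite parityE.
Qed.

Lemma slide_act_neq k (a : P n) al c r (u : F al) :
  a.1 k = 0%N -> a.2 k = 0%N ->
  slide k (act a (gn (c :: r) u)) = act a (slide k (gn (c :: r) u)).
Proof.
move=> a1 a2; rewrite act_cons !slide_cons raddf_sum /= vaddE a2 addn0.
apply: eq_bigr => t _; rewrite /= act_cons; congr (gn (_ :: _) u).
by apply: pairP => j; rewrite ?pE;
  have [->|_] := eqVneq j k; rewrite ?a1 ?a2; lia.
Qed.

Lemma slide_diff_nil k j al (u : F al) : slide k (diff j (gn [::] u)) = 0.
Proof. by rewrite /diff /= raddfB /= !act_nil !slide_nil subr0. Qed.

Lemma slide_diff_neq k j al c r (u : F al) : j != k ->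
  slide k (diff j (gn (c :: r) u)) = diff j (slide k (gn (c :: r) u)).
Proof.
move=> jk; rewrite /diff /= raddfB /=.
by rewrite !slide_act_neq //= vE // eq_sym (negPf jk).
Qed.

Lemma move0 k c : move k 0 0 c = c.
Proof. by apply: pairP => j; rewrite ?pE; lia. Qed.

(** The sum telescopes: its term [t] contributes the morphism with [t] units moved minus the one
    with [t.+1] units moved. *)
Lemma diff_slide k al c r (u : F al) :
  diff k (slide k (gn (c :: r) u)) =
  gn (c :: r) u - gn (move k (c.2 k) (c.2 k) c :: r) u.
Proof.
pose G t := gn (move k t t c :: r) u.
have G0 : gn (c :: r) u = G 0%N by rewrite /G move0.
rewrite [in RHS]G0 -[RHS]/(G 0%N - G (c.2 k)) slide_cons raddf_sum /=.
rewrite -opprB -telescope_sumr // -sumrN big_mkord; apply: eq_bigr => t _ /=.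
rewrite opprB /diff /= !act_cons /G; congr (gn (_ :: r) u - gn (_ :: r) u).
  apply: pairP => j; rewrite ?pE /= ?vE;
  by have [->|_] := eqVneq j k; have := ltn_ord t; lia.
apply: pairP => j; rewrite ?pE /= ?vE;
by have [->|_] := eqVneq j k; have := ltn_ord t; lia.
Qed.

(** Sliding [(f, g + 1)] and sliding [(f + 1, g)] produce the same morphisms, except for the term
    [t = 0] of the former, which is [(f, g)]. *)
Lemma slide_diff k al c r (u : F al) :
  slide k (diff k (gn (c :: r) u)) = gn (c :: r) u.
Proof.
rewrite /diff /= raddfB /= !act_cons !slide_cons !pE /= v0E genE eqxx.
rewrite addn0 addn1 big_ord_recl /= -addrA -sumrB big1 ?addr0 => [|t _].
  congr (gn (_ :: r) u); apply: pairP => j;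
  by rewrite ?pE /= ?vE; lia.
apply/eqP; rewrite subr_eq0; apply/eqP; congr (gn (_ :: r) u); apply: pairP =>
  j;
rewrite ?pE /= ?vE /bump /=;
by have [->|_] := eqVneq j k; lia.
Qed.

Definition rel_up (k : 'I_n) (i j : ix) :=
  validr i ==> [&& validr j, endv j == vadd (endv i) (gen k) & size j.2 == size
    i.2].

Lemma slide_supp k i (u : Fix i) : in_supp (rel_up k i) (slide k (dinj u)).
Proof.
case: i u => al [|c r] u; rewrite gnE ?slide_nil ?slide_cons //=.
apply: in_supp_sum => t _; apply: in_supp_dinj; apply/implyP.
rewrite !validr_cons => /andP[-> /vleP h]; rewrite !endv_cons eqxx andbT /=.
have h' j : (weight (move k t t.+1 c) j + (j == k) = weight c j)%N.
  have := ltn_ord t; rewrite !weightE move1E move2E.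
  by have [->|_] := eqVneq j k; lia.
apply/andP; split; first by apply/vleP => j; move: (h j) (h' j); lia.
by apply/eqP/vecP => j; move: (h j) (h' j); rewrite !vE; lia.
Qed.

(** The counterpart of [chi] for adding the direction [i] to a cube that lacks it. *)
Definition psi (i : 'I_n) (e : vec) : int :=
  if e i == 0%N then sg (cnt i e) else 0.

Lemma vadd_gen_sub (e : vec) i : vsub (vadd e (gen i)) (gen i) = e.
Proof. by apply: vecP => j; rewrite !vE; lia. Qed.

Lemma chi_psi (i j : 'I_n) (e : vec) : j != i ->
  chi j (vadd e (gen i)) * psi i e = - (psi i (vsub e (gen j)) * chi j e).
Proof.
move=> ji; rewrite /chi /psi !vE [i == j]eq_sym (negPf ji) addn0 subn0.
case: (e j =P 1%N) => [ej|]; last by rewrite mulr0 mul0r oppr0.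
case: (e i =P 0%N) => [ei|]; last by rewrite mulr0 mul0r oppr0.
have e1 : vadd e (gen i) i = 1%N by rewrite !vE eqxx ei.
rewrite (cnt_vsub j e1) vadd_gen_sub (cnt_vsub i ej).
have [lt|gt|/val_inj e'] := ltngtP i j; last by rewrite e' eqxx in ji.
  by rewrite add0n add1n sgS mulNr mulrC.
by rewrite add0n add1n sgS mulrN mulrC.
Qed.

Lemma chi_psi_id (i : 'I_n) (e : vec) :
  e i = 0%N -> chi i (vadd e (gen i)) * psi i e = 1.
Proof.
move=> ei; have e1 : vadd e (gen i) i = 1%N by rewrite !vE eqxx ei.
by rewrite /chi /psi e1 ei !eqxx (cnt_vsub i e1) vadd_gen_sub ltnn add0n sg_sq.
Qed.

Lemma psi_chi_id (i : 'I_n) (e : vec) :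
  e i = 1%N -> psi i (vsub e (gen i)) * chi i e = 1.
Proof.
by move=> ei; rewrite /chi /psi !vE ei !eqxx (cnt_vsub i ei) ltnn add0n sg_sq.
Qed.

Definition tau1 (k : 'I_n) : U -> U := -%R \o (slide k \o (dg_end (psi k) \o
  parity)).
HB.instance Definition _ k :=
  GRing.Additive.copy (tau1 k) (-%R \o (slide k \o (dg_end (psi k) \o parity))).

Lemma tau1_nil k al (u : F al) : tau1 k (gn [::] u) = 0.
Proof.
rewrite /tau1 /= parityE (raddfMz (dg_end _)) /= dg_endE !(raddfMz (slide k))
  /= slide_nil.
by rewrite !mul0rz oppr0.
Qed.

Definition rel_tau (i j : ix) :=
  validr i ==> [exists k, [&& validr j, endv i k == 0%N,
                     endv j == vadd (endv i) (gen k) & size j.2 == size i.2]].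

Lemma tau1_supp k i (u : Fix i) : in_supp (rel_tau i) (tau1 k (dinj u)).
Proof.
case: i u => al r /= u; apply: in_suppN.
rewrite /= gnE parityE (raddfMz (dg_end _)) /= dg_endE !(raddfMz (slide k));
  apply: in_suppMz; rewrite /psi.
case: eqP => [ek|_]; last exact: in_supp0.
apply: in_suppMz; apply: sub_in_supp (@slide_supp k (al, r) u) => j.
move=> /implyP h; apply/implyP => /h /and3P[vj ej sj]; apply/existsP; exists k.
by rewrite vj ej sj ek eqxx.
Qed.

(** What the contraction in coordinate [k] leaves: cubes without the direction [k], with all units
    of that coordinate moved from g to f. On chains of length 0 there is no morphism to slide along,
    so they stay as they are. *)
Definition collapseg (k : 'I_n) (i : ix) (u : F i.1) : U :=
  if i.2 is c :: r then
    if endv i k == 0%N then gn (move k (c.2 k) (c.2 k) c :: r) u else 0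
  else gn i.2 u.
Lemma collapsegD k i : {morph @collapseg k i : u v / u + v}.
Proof.
move=> u v; rewrite /collapseg; case: i.2 => [|c r]; first exact: gnD.
by case: ifP => _; [exact: gnD | rewrite addr0].
Qed.
Definition collapse k : U -> U := dlift (collapsegD k).
HB.instance Definition _ k := GRing.Additive.copy (collapse k) (dlift
  (collapsegD k)).

Lemma collapse_nil k al (u : F al) : collapse k (gn [::] u) = gn [::] u.
Proof. exact: dlift_dinj. Qed.

Lemma collapse_cons k al c r (u : F al) : collapse k (gn (c :: r) u) =
  if endv (al, c :: r) k == 0%N then gn (move k (c.2 k) (c.2 k) c :: r) u else
    0.
Proof. exact: dlift_dinj. Qed.

Lemma weight_move k (c : P n) : weight (move k (c.2 k) (c.2 k) c) = weight c.
Proof.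
apply: vecP => j; rewrite !weightE move1E move2E.
by have [->|_] := eqVneq j k; lia.
Qed.

Definition rel_same (i j : ix) :=
  [&& endv j == endv i, size j.2 == size i.2 & validr j == validr i].

Lemma collapse_supp k i (u : Fix i) : in_supp (rel_same i) (collapse k (dinj
  u)).
Proof.
case: i u => al [|c r] u; rewrite gnE ?collapse_nil ?collapse_cons.
  by apply: in_supp_dinj; rewrite /rel_same !eqxx.
case: ifP => // _; apply: in_supp_dinj.
by rewrite /rel_same !endv_cons !validr_cons weight_move !eqxx.
Qed.

Definition cube_end (i : ix) := validr i && [forall k, endv i k <= 1]%N.

Lemma vdiff_cube_end x : in_supp cube_end x -> in_supp cube_end (vdiff x).
Proof.
apply: in_supp_additive; first exact: vdiff_supp.
move=> i j /andP[vi /forallP di] /existsP[k /and4P[_ /eqP e _ v]].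
rewrite /cube_end (implyP v) //=; apply/forallP => l; rewrite e vsubE.
by apply: leq_trans (leq_subr _ _) (di l).
Qed.

(** In direction [k] exactly one composite survives on chains of positive length. If [k] is not a
    direction of the cube it is [diff_slide], which leaves the collapsed chain; if it is one, it is
    [slide_diff], which gives the identity. *)
Lemma vdiff_tau1 k x : in_supp cube_end x ->
  vdiff (tau1 k x) + tau1 k (vdiff x) = x - collapse k x.
Proof.
apply: (eq_additive_in (f := (vdiff \o tau1 k) \+ (tau1 k \o vdiff))
                       (g := idfun \- collapse k)) => -[al r] /= u.
move=> /andP[vi /forallP di]; rewrite gnE /= in vi di *.
have e1 : vdiff (tau1 k (gn r u)) =
    \sum_j diff j (dg_end (chi j) (slide k (dg_end (psi k) (gn r u)))).
  rewrite /vdiff {1}/tau1 /= (raddfN parity) /= parity_slide -dg_end_parity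
    parityK.
  by rewrite -sumrN; apply: eq_bigr => j _;
    rewrite (raddfN (dg_end _)) (raddfN (diff j)) opprK.
have e2 : tau1 k (vdiff (gn r u)) =
    \sum_j slide k (dg_end (psi k) (diff j (dg_end (chi j) (gn r u)))).
  rewrite /tau1 /= /vdiff (raddfN parity) (raddfN (dg_end _)) (raddfN (slide
    k)) opprK.
  rewrite (raddf_sum parity) (raddf_sum (dg_end _)) (raddf_sum (slide k)).
  by apply: eq_bigr => j _ /=; rewrite parity_diff -dg_end_parity parityK.
rewrite {}e1 {}e2 -big_split /=; case: r vi di => [|c r] vi di.
  rewrite collapse_nil subrr big1 // => j _.
  rewrite dg_end_diff dg_end_dg_end !dg_endE (raddfMz (diff j)) !(raddfMz
    (slide k)) /=.
  by rewrite slide_nil slide_diff_nil !mul0rz !raddf0 addr0.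
set e := endv (al, c :: r); set g := gn (c :: r) u.
(* The weights depend on the last object only. On valid chains [slide k] raises it by [gen k], and
   [diff j] lowers it by [gen j], so the signs come out as scalars. *)
have E j : diff j (dg_end (chi j) (slide k (dg_end (psi k) g))) +
     slide k (dg_end (psi k) (diff j (dg_end (chi j) g))) =
   diff j (slide k g) *~ (chi j (vadd e (gen k)) * psi k e) +
   slide k (diff j g) *~ (psi k (vsub e (gen j)) * chi j e).
  congr (_ + _).
    rewrite dg_endE !raddfMz /= -/e.
    rewrite [dg_end _ _](@dg_const_in _ _ (rel_up k (al, c :: r)) _ (chi j
      (vadd e (gen k)))).
    - by rewrite raddfMz mulrzA.
    - by move=> i /implyP /(_ vi) /and3P[_ /eqP h _] /=; rewrite h.
    - exact: slide_supp.
  by rewrite dg_end_diff dg_end_dg_end dg_endE /= !raddfMz.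
(* For [j] other than [k] the operators commute and the scalars are opposite, so only [j = k]
   remains. *)
rewrite (eq_bigr _ (fun j _ => E j)) (bigD1 k) //= big1 ?addr0; last first.
  by move=> j jk; rewrite slide_diff_neq // chi_psi // mulrNz addrC subrr.
rewrite collapse_cons -/e.
have := di k; rewrite -/e; case ek : (e k) => [|[|m]] // _.
  by rewrite chi_psi_id // /chi ek /= mulr0 mulr0z addr0 diff_slide.
by rewrite psi_chi_id // /psi ek /= mulr0 mulr0z add0r slide_diff subr0.
Qed.

(** Purely formal: [collapse k] differs from the identity by [vdiff \o tau1 k + tau1 k \o vdiff],
    and [vdiff] squares to 0. *)
Lemma collapse_vdiff k x : in_supp cube_end x ->
  collapse k (vdiff x) = vdiff (collapse k x).
Proof.
move=> Dx; have h : collapse k x = x - (vdiff (tau1 k x) + tau1 k (vdiff x)).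
  by rewrite vdiff_tau1 // opprB addrC subrK.
have h' : collapse k (vdiff x) = vdiff x - (vdiff (tau1 k (vdiff x)) + tau1 k
  (vdiff (vdiff x))).
  by rewrite vdiff_tau1 ?opprB 1?addrC ?subrK //; apply: vdiff_cube_end.
by rewrite h' vdiff_vdiff raddf0 addr0 h (raddfB vdiff) (raddfD vdiff) /=
  vdiff_vdiff add0r.
Qed.

Fixpoint sweep (l : seq 'I_n) (c : P n) : P n :=
  if l is k :: l' then
    move k ((sweep l' c).2 k) ((sweep l' c).2 k) (sweep l' c)
  else c.

Lemma weight_sweep l c : weight (sweep l c) = weight c.
Proof. by elim: l => //= k l IHl; rewrite weight_move. Qed.

Lemma sweepE l c j :
  (sweep l c).1 j = (c.1 j + (j \in l) * c.2 j)%N /\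
  (sweep l c).2 j = ((j \notin l) * c.2 j)%N.
Proof.
elim: l => [|k l [IH1 IH2]]; first by rewrite mul0n mul1n addn0.
rewrite in_cons negb_or; change (sweep (k :: l) c) with
  (move k ((sweep l c).2 k) ((sweep l c).2 k) (sweep l c)).
rewrite !pE IH1 IH2; have [jk|_] := eqVneq j k;
  last by rewrite /= !mul0n addn0 subn0.
by rewrite -jk IH2; case: (j \in l); rewrite /= ?mul0n ?mul1n; lia.
Qed.

Lemma rel_tau_cube_end i j : cube_end i -> rel_tau i j -> cube_end j.
Proof.
move=> /andP[vi /forallP di] /implyP /(_ vi) /existsP[k].
move=> /and4P[vj /eqP ek /eqP ej _].
rewrite /cube_end vj; apply/forallP => l; move: (di l); rewrite ej vaddE genE.
by have [->|_] := eqVneq l k; rewrite ?ek ?addn0.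
Qed.

(* The contractions of the single coordinates combine to one of their tensor
   product. *)
Lemma sweep_contraction (l : seq 'I_n) : exists T E : {additive U -> U},
  [/\ forall i u, in_supp (rel_tau i) (T (@dinj _ Fix i u)),
      forall al (u : F al), T (gn [::] u) = 0,
      forall x, in_supp cube_end x -> vdiff (T x) + T (vdiff x) = x - E x,
      forall al (u : F al), E (gn [::] u) = gn [::] u &
      forall al c r (u : F al), E (gn (c :: r) u) =
        if all (fun k => endv (al, c :: r) k == 0%N) l
        then gn (sweep l c :: r) u else 0].
Proof.
elim: l => [|k l [T [E [T1 T2 T3 E1 E2]]]].
  exists (\0 : {additive U -> U}), (idfun : {additive U -> U}).
  by split=> //= x _; rewrite raddf0 addr0 subrr.
(* With [A = collapse k], a chain map, [1 - A E = (1 - A) + A (1 - E)]; hence homotopies for [A] and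
   for [E] combine to [tau1 k + A T]. *)
exists (tau1 k \+ (collapse k \o T)), (collapse k \o E); split.
- move=> i u; apply: in_suppD; first exact: tau1_supp.
  apply: in_supp_additive (T1 i u); first exact: collapse_supp.
  move=> j j' /implyP h /and3P[/eqP ej /eqP sj /eqP vj].
  apply/implyP => /h /existsP[k' hk']; apply/existsP; exists k'.
  by rewrite ej sj vj.
- by move=> al u /=; rewrite tau1_nil T2 raddf0 addr0.
- move=> x Dx /=; rewrite raddfD /= -collapse_vdiff; last first.
    by apply: in_supp_additive Dx => //; exact: rel_tau_cube_end.
  by rewrite addrACA -(raddfD (collapse k)) /= T3 // vdiff_tau1 // (raddfB
    (collapse k)) /= addrA subrK.
- by move=> al u /=; rewrite E1 collapse_nil.
- move=> al c r u /=; rewrite E2; case: ifP => h; last by rewrite raddf0 andbF.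
  by rewrite andbT collapse_cons !endv_cons weight_sweep.
Qed.

(** The morphism added runs from the unit to the last object with everything in f and nothing in g,
    the form in which a complete sweep leaves it. *)
Definition augm_secg (i : ix) (u : F i.1) : U := gn ((endv i, v0 n) :: i.2) u.
Lemma augm_secgD i : {morph @augm_secg i : u v / u + v}.
Proof. exact: gnD. Qed.
Definition augm_sec : U -> U := dlift augm_secgD.
HB.instance Definition _ := GRing.Additive.copy augm_sec (dlift augm_secgD).

Lemma augm_secE al r (u : F al) : augm_sec (gn r u) = gn ((endv (al, r), v0 n)
  :: r) u.
Proof. exact: dlift_dinj. Qed.

Lemma endv_augm_sec al r : endv (al, (endv (al, r), v0 n) :: r) = v0 n.
Proof. by rewrite endv_cons; apply: vecP => j; rewrite vsubE weightE v0E /=;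
  lia. Qed.

Lemma augm_augm_sec x : augm (augm_sec x) = x.
Proof.
apply: (eq_on_gn (f := augm \o augm_sec) (g := idfun)) => al r u /=.
rewrite augm_secE /augm /= dg_endE endv_augm_sec /isz eqxx.
exact: drop_last_cons.
Qed.

Definition nil_part : U -> U := dg (fun i : ix => if nilp i.2 then 1 else 0).
HB.instance Definition _ :=
  GRing.Additive.copy nil_part (dg (fun i : ix => if nilp i.2 then 1 else 0)).

Definition nilx (i : ix) := nilp i.2.

Lemma nil_part_nil x : in_supp nilx (nil_part x).
Proof. by move=> i; rewrite /nilx coef_dg => /negPf->; rewrite mulr0z. Qed.

Lemma augm_nil x : in_supp nilx x -> augm x = 0.
Proof.
apply: (eq_additive_in (f := augm) (g := \0)) => -[al [|c r]] /= u // _.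
by rewrite gnE /augm /= dg_endE raddfMz /= drop_last_nil mul0rz.
Qed.

Lemma augm_neq0 x : in_supp (fun i => endv i != v0 n) x -> augm x = 0.
Proof.
apply: (eq_additive_in (f := augm) (g := \0)) => -[al r] /= u h.
by rewrite gnE /augm /= dg_endE /isz (negPf h) mulr0z raddf0.
Qed.

(** Sweeping through all coordinates kills the chains of positive length whose last object is not
    the unit and brings the remaining ones to the normal form produced by [augm_sec]. *)
Lemma column_contraction : exists T : {additive U -> U},
  [/\ forall i u, in_supp (rel_tau i) (T (@dinj _ Fix i u)),
      forall x, in_supp nilx x -> T x = 0 &
      forall x, in_supp cube_end x -> vdiff (T x) + T (vdiff x) = x - (augm_sec
        (augm x) + nil_part x)].
Proof.
have [T [E [T1 T2 T3 E1 E2]]] := sweep_contraction (enum 'I_n).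
exists T; split=> // [|x Dx].
  move=> x; apply: (eq_additive_in (f := T) (g := \0)) =>
    -[al [|c r]] /= u // _.
  exact: T2.
rewrite T3 //; congr (_ - _); move: Dx.
apply: (eq_additive_in (f := E) (g := (augm_sec \o augm) \+ nil_part)) =>
  -[al r] /= u.
rewrite gnE /= => /andP[vi _].
have -> : nil_part (gn r u) = gn r u *~ (if nilp r then 1 else 0) by exact: dgE.
case: r vi => [|c r] vi.
  by rewrite E1 augm_nil ?raddf0 ?add0r //; apply: in_supp_dinj.
rewrite E2 mulr0z addr0 /augm /= dg_endE /isz.
have -> : all (fun k => endv (al, c :: r) k == 0%N) (enum 'I_n) =
          (endv (al, c :: r) == v0 n).
  apply/allP/eqP => [h|-> k _]; last by rewrite v0E.
  by apply: vecP => k; rewrite v0E; apply/eqP/h; rewrite mem_enum.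
case: eqP => [e0|_]; last by rewrite mulr0z !raddf0.
rewrite mulr1z drop_last_cons augm_secE; congr (gn (_ :: r) u).
(* Validity turns the vanishing of the truncated difference into [weight c = endv (al, r)], so that
   [c] is swept to exactly [(endv (al, r), v0 n)]. *)
move: vi; rewrite validr_cons => /andP[_ /vleP le].
apply: pairP => j; have [s1 s2] := sweepE (enum 'I_n) c j;
  rewrite ?s1 ?s2 mem_enum /=.
  by move: (le j) (eq_vec e0 j); rewrite endv_cons vsubE weightE v0E; lia.
by rewrite v0E.
Qed.

(** * Acyclicity of the rows and of the columns *)

Definition wsum (e : vec) : nat := \sum_k e k.

Lemma wsum_add (e : vec) k : wsum (vadd e (gen k)) = (wsum e).+1.
Proof.
rewrite /wsum; under eq_bigr => j _ do rewrite vaddE genE.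
rewrite big_split /= -addn1; congr (_ + _)%N.
by rewrite (bigD1 k) //= eqxx big1 // => j /negPf->.
Qed.

Lemma wsum_sub (e : vec) k : e k = 1%N -> (wsum (vsub e (gen k))).+1 = wsum e.
Proof.
move=> ek; rewrite -(wsum_add _ k); congr wsum; apply: vecP => j.
by rewrite vaddE vsubE genE; have [->|_] := eqVneq j k; rewrite ?ek; lia.
Qed.

(** The degree is the number of morphisms plus the dimension of the cube. The cubical complex keeps
    its degree, whereas [augm] lowers the degree by one: Leech degree [k] corresponds to total
    degree [k.+1]. *)
Definition tot_deg (m : nat) (i : ix) :=
  cube_end i && (size i.2 + wsum (endv i) == m)%N.

Lemma hdiff_tot_deg m x : in_supp (tot_deg m.+1) x ->
  in_supp (tot_deg m) (hdiff x).
Proof.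
apply: in_supp_additive; first exact: hdiff_supp.
move=> i j /andP[/andP[vi di] /eqP w] /and3P[/eqP e /eqP s /implyP/(_ vi) v].
by rewrite /tot_deg /cube_end v e di /= -eqSS -w -s addSn.
Qed.

Lemma vdiff_tot_deg m x : in_supp (tot_deg m.+1) x ->
  in_supp (tot_deg m) (vdiff x).
Proof.
move=> Tx; have Dx : in_supp cube_end x by apply: sub_in_supp Tx => i /andP[].
apply: (sub_in_supp (Q := fun i => cube_end i && (size i.2 + wsum (endv i) ==
  m)%N)) => //.
apply: in_suppI; first exact: vdiff_cube_end.
apply: in_supp_additive Tx; first exact: vdiff_supp.
move=> i j /andP[_ /eqP w] /existsP[k /and4P[/eqP ek /eqP e /eqP s _]].
by rewrite -eqSS -w -(wsum_sub ek) e s addnS.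
Qed.

Lemma tdiff_tot_deg m x : in_supp (tot_deg m.+1) x ->
  in_supp (tot_deg m) (tdiff x).
Proof. by move=> Tx; apply: in_suppD; [exact: hdiff_tot_deg | exact:
  vdiff_tot_deg]. Qed.

Definition rel_extra_deg (i j : ix) :=
  [&& endv j == endv i, size j.2 == (size i.2).+1 & validr i ==> validr j].

Lemma extra_deg_supp i (u : Fix i) : in_supp (rel_extra_deg i) (extra_deg (dinj
  u)).
Proof.
case: i u => al r /= u; rewrite gnE /extra_deg /= parityE raddfMz /= appendE.
apply: in_suppMz; apply: in_supp_dinj.
have e : weight pid = v0 n by apply: vecP => k; rewrite weightE v0E.
rewrite /rel_extra_deg validr_cons endv_cons e eqxx /= andbC.
have -> : vsub (endv (al, r)) (v0 n) = endv (al, r).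
  by apply: vecP => k; rewrite vsubE v0E subn0.
by rewrite eqxx andbT; apply/implyP => ->; apply/vleP => k; rewrite v0E.
Qed.

(** The rows, with the chains of length 0 included, are contracted by [extra_deg]. Induction on a
    strict bound for the dimension of the cubes carries this over to the total complex. *)
Lemma row_acyclic m z : in_supp (tot_deg m) z -> tdiff z = 0 ->
  exists2 w, in_supp (tot_deg m.+1) w & z = tdiff w.
Proof.
move=> Tz dz.
have [s bz] : exists s, in_supp (fun i => wsum (endv i) < s)%N z.
  by exists m.+1; apply: sub_in_supp Tz => i /andP[_ /eqP<-];
    rewrite ltnS leq_addl.
elim: s z Tz dz bz => [|s IHs] z Tz dz bz.
  by exists 0; [exact: in_supp0 | rewrite raddf0; apply: dsum_ext => i;
    exact: bz].
have Tsz : in_supp (tot_deg m.+1) (extra_deg z).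
  apply: in_supp_additive Tz; first exact: extra_deg_supp.
  move=> i j /andP[/andP[vi di] /eqP w] /and3P[/eqP e /eqP sz /implyP/(_ vi) v].
  by rewrite /tot_deg /cube_end v e di /= sz addSn w.
(* As [hdiff z = - vdiff z], both error terms contain [vdiff], which lowers the dimension of the
   cube. *)
have Eq : z - tdiff (extra_deg z) = - (extra_deg (vdiff z) + vdiff (extra_deg
  z)).
  have -> : vdiff z = - hdiff z by apply/eqP; rewrite -addr_eq0 addrC;
    exact/eqP.
  rewrite -{1}(hdiff_extra_deg z) /tdiff /= raddfN /= opprD addrACA subrr add0r
    opprD opprK.
  by [].
have [w Tw ew] : exists2 w, in_supp (tot_deg m.+1) w & z - tdiff (extra_deg z)
  = tdiff w.
  apply: IHs.
  - by apply: in_suppB => //; exact: tdiff_tot_deg.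
  - by rewrite raddfB /= tdiff_tdiff dz subr0.
  have vdb x : in_supp (fun i => wsum (endv i) < s.+1)%N x ->
               in_supp (fun i => wsum (endv i) < s)%N (vdiff x).
    apply: in_supp_additive; first exact: vdiff_supp.
    by move=> i j h /existsP[k /and4P[/eqP ek /eqP-> _ _]];
      rewrite -(wsum_sub ek) in h.
  have sgb t x : in_supp (fun i => wsum (endv i) < t)%N x ->
                 in_supp (fun i => wsum (endv i) < t)%N (extra_deg x).
    apply: in_supp_additive; first exact: extra_deg_supp.
    by move=> i j h /and3P[/eqP-> _ _].
  rewrite Eq; apply: in_suppN; apply: in_suppD; first by apply/sgb/vdb.
  by apply/vdb/sgb.
exists (extra_deg z + w); first exact: in_suppD.
by rewrite raddfD /= -ew addrC subrK.
Qed.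

(** The total complex modulo chains of length 0 is compared with the Leech complex by induction on
    the length: subtracting [tdiff (T z)] leaves, besides a part of length 0, terms that contain
    [hdiff] and are therefore shorter. *)
Lemma column_acyclic m z :
  in_supp (tot_deg m) z -> in_supp nilx (tdiff z) -> augm z = 0 ->
  exists w, [/\ in_supp (tot_deg m.+1) w, in_supp nilx (z - tdiff w) & augm w =
    0].
Proof.
have [T [T1 T2 T3]] := column_contraction.
have Tsz t x : in_supp (fun i => validr i && (size i.2 <= t))%N x ->
               in_supp (fun i => validr i && (size i.2 <= t))%N (T x).
  apply: in_supp_additive => // i j /andP[vi si] /implyP/(_ vi)/existsP[k].
  by move=> /and4P[-> _ _ /eqP->].
have hsz t x : in_supp (fun i => validr i && (size i.2 <= t.+1))%N x ->
               in_supp (fun i => validr i && (size i.2 <= t))%N (hdiff x).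
  apply: in_supp_additive; first exact: hdiff_supp.
  by move=> i j /andP[vi si] /and3P[_ /eqP s /implyP/(_ vi)->];
    rewrite -s in si.
move=> Tz nz ez.
have [s bz] : exists s, in_supp (fun i => validr i && (size i.2 <= s))%N z.
  exists m; apply: sub_in_supp Tz => i /andP[/andP[-> _] /eqP<-].
  exact: leq_addr.
elim: s z Tz nz ez bz => [|s IHs] z Tz nz ez bz.
  exists 0; split; [exact: in_supp0 | rewrite (raddf0 tdiff) subr0 | exact:
    raddf0].
  by apply: sub_in_supp bz => i /andP[_]; rewrite leqn0.
have Dz : in_supp cube_end z by apply: sub_in_supp Tz => i /andP[].
have TTz : in_supp (tot_deg m.+1) (T z).
  apply: in_supp_additive Tz => // i j /andP[Di /eqP w] rij.
  rewrite /tot_deg (rel_tau_cube_end Di rij) /=; case/andP: Di => vi _.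
  move: rij => /implyP/(_ vi)/existsP[k /and4P[_ _ /eqP-> /eqP->]].
  by rewrite wsum_add addnS w.
(* [T] adds a direction to the cube, so its values never end at the unit. *)
have eTz : augm (T z) = 0.
  apply: augm_neq0; apply: in_supp_additive Dz => // i j /andP[vi _].
  move=> /implyP/(_ vi)/existsP[k /and4P[_ _ /eqP-> _]].
  by apply/eqP => /eq_vec/(_ k); rewrite vaddE genE v0E eqxx addn1.
(* [T] kills [tdiff z], which has length 0; this replaces [T (vdiff z)] by [- T (hdiff z)]. *)
have Eq : z - tdiff (T z) = nil_part z - T (hdiff z) - hdiff (T z).
  have Tv : T (vdiff z) = - T (hdiff z).
    apply/eqP; rewrite -addr_eq0 addrC -raddfD; apply/eqP; exact: T2.
  have := T3 z Dz; rewrite ez raddf0 add0r Tv => /eqP.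
  rewrite subr_eq => /eqP e; rewrite /tdiff /= e opprD (addrC (- _)) addrA.
  by congr (_ - _); rewrite opprD opprB addrA (addrC z) subrK.
have [w [Tw nw ew]] : exists w, [/\ in_supp (tot_deg m.+1) w,
    in_supp nilx (z - tdiff (T z) - tdiff w) & augm w = 0].
  apply: IHs.
  - by apply: in_suppB => //; exact: tdiff_tot_deg.
  - by rewrite raddfB /= tdiff_tdiff subr0.
  - by rewrite raddfB /= augm_tdiff eTz raddf0 ez subr0.
  rewrite Eq; apply: in_suppB; last by apply: hsz; exact: Tsz.
  apply: in_suppB; last by apply: Tsz; exact: hsz.
  have := in_suppI (nil_part_nil z) (in_supp_dg _ bz); apply: sub_in_supp => i.
  by move=> /andP[/nilP ni /andP[-> _]]; rewrite ni.
exists (T z + w); split; first exact: in_suppD.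
  by rewrite (raddfD tdiff) /= opprD addrA.
by rewrite raddfD /= eTz ew addr0.
Qed.

(** * The Leech complex *)

Definition represents (x : LC F) (X : U) := forall al p, X (al, rev p) = x al p.

Definition leech_deg k (i : ix) := validr i && (size i.2 == k).

Lemma valid_tot al p : valid al p = vle (tot p) al.
Proof.
elim: p al => [|a p IHp] al /=; first by apply/esym/vleP => i; rewrite v0E.
rewrite IHp; apply/andP/vleP => [[/vleP h /vleP h'] i|h].
  by move: (h i) (h' i); rewrite !vE; lia.
by split; apply/vleP => i; move: (h i); rewrite !vE; lia.
Qed.

Lemma tot_rev p : tot (rev p) = tot p.
Proof.
have tot_rcons r a : tot (rcons r a) = vadd (weight a) (tot r).
  elim: r => //= b r ->; apply: vecP => i; rewrite !vaddE; lia.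
by elim: p => //= a p IHp; rewrite rev_cons tot_rcons IHp.
Qed.

Lemma valid_validr al p : valid al p = validr (al, rev p).
Proof. by rewrite valid_tot /validr /= tot_rev. Qed.

Lemma represents_in_supp k x X : Lchain k x -> represents x X ->
  in_supp (leech_deg k) X.
Proof.
move=> [_ xk] xX [al r] h; rewrite -(revK r) xX xk //.
by rewrite valid_validr revK size_rev.
Qed.

Lemma represents_Lchain k x X : in_supp (leech_deg k) X -> represents x X ->
  Lchain k x.
Proof.
move=> Xk xX; split.
  have [s Xs] := dsumP X; exists [seq (e.1, rev e.2) | e <- s] => al p h.
  rewrite -xX Xs //; apply: contraNN h => h; apply/mapP; exists (al, rev p) =>
    //=.
  by rewrite revK.
by move=> al p h; rewrite -xX Xk // /leech_deg -valid_validr /= size_rev.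
Qed.

Lemma Lchain_represents k x : Lchain k x -> exists X, represents x X.
Proof.
move=> [[L xL] _].
have fs : exists s : seq ix, forall i : ix, i \notin s -> x i.1 (rev i.2) = 0.
  exists [seq (e.1, rev e.2) | e <- L] => -[al r] /= h; apply: xL.
  apply: contraNN h => h; apply/mapP; exists (al, rev r) => //=.
  by rewrite revK.
by exists (DSum fs) => al p /=; rewrite revK.
Qed.

Lemma represents_inj x X Y : represents x X -> represents x Y -> X = Y.
Proof.
by move=> xX xY; apply: dsum_ext => -[al r]; rewrite -(revK r) xX xY.
Qed.

Lemma mergeAt_rcons j (s : seq (P n)) z :
  (j.+1 < size s)%N -> mergeAt j (rcons s z) = rcons (mergeAt j s) z.
Proof.
elim: j s => [|j IHj] [|a s] //=; first by case: s.
by move=> h; rewrite IHj.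
Qed.

Lemma mergeAt_last (s : seq (P n)) b z :
  mergeAt (size s) (rcons (rcons s b) z) = rcons s (pcomp b z).
Proof. by elim: s => //= a s ->. Qed.

(** The recursion of [hdiff] starts from the last morphism, while [mergeAt] counts from the first;
    induction on the end of the list matches the two. *)
Lemma hdiff_faces al a p (u : F al) :
  hdiff (gn (rev (a :: p)) u) =
  gn (rev p) (Fm F (vsub al (weight a)) al a.1 a.2 u) +
  \sum_(j < size p) gn (rev (mergeAt j (a :: p))) u *~ sg j.+1.
Proof.
elim/last_ind: p => [|p z IHp].
  by rewrite /= big_ord0 addr0 hdiff_cons hdiff_nil raddf0 add0r act_nil.
rewrite -rcons_cons !rev_rcons hdiff_cons IHp raddfD raddf_sum /= appendE
  size_rcons.
rewrite big_ord_recr /= -addrA; congr (_ + (_ + _)).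
  apply: eq_bigr => j _; rewrite raddfMz /= appendE -rcons_cons mergeAt_rcons
    //=.
    by rewrite rev_rcons.
  by rewrite ltnS.
rewrite size_rev /=; congr (_ *~ _).
rewrite -rcons_cons; have : size (a :: p) = (size p).+1 by [].
case/lastP: (a :: p) => [|s b] //; rewrite size_rcons => -[<-].
by rewrite rev_rcons act_cons mergeAt_last rev_rcons.
Qed.

Lemma leech_diff_faces k al a p (u : F al) : size p = k ->
  leech_diff (gn (rev (a :: p)) u) =
  gn (rev p) (Fm F (vsub al (weight a)) al a.1 a.2 u) +
  \sum_(j < k) gn (rev (mergeAt j (a :: p))) u *~ sg j.+1 +
  gn (rev (take k (a :: p))) u *~ sg k.+1.
Proof.
move=> sp; rewrite /leech_diff /= hdiff_faces sp; congr (_ + _).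
rewrite parityE raddfMz /= size_rev /= sp; congr (_ *~ _).
have : size (a :: p) = k.+1 by rewrite /= sp.
case/lastP: (a :: p) => [|s b] //; rewrite size_rcons => -[<-].
by rewrite rev_rcons drop_last_cons -cats1 take_size_cat.
Qed.

Lemma sgnE (V : zmodType) i (v : V) : sgn i v = v *~ sg i.
Proof.
rewrite /sgn; elim: i => [|i IHi] //=; rewrite sgS mulrNz -IHi.
by case: (odd i) => //=; rewrite opprK.
Qed.

Lemma coef_gn al r (u : F al) s : gn r u (al, s) = if r == s then u else 0.
Proof.
case: eqP => [<-|rs]; first exact: (@coef_dinjxx _ Fix (al, r) u).
by apply: (@coef_dinj_neq _ Fix (al, r) (al, s)); apply/eqP => -[].
Qed.

Lemma coef_gn_neq al be r (u : F al) s : al != be -> gn r u (be, s) = 0.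
Proof.
move=> ab; apply: (@coef_dinj_neq _ Fix (al, r) (be, s)).
by apply: contraNneq ab => -[->].
Qed.

Lemma gn0 al r : gn r (0 : F al) = 0.
Proof. exact: raddf0. Qed.

Definition face0 (e : ix) (u : F e.1) : U :=
  if e.2 is a :: p then gn (rev p) (Fm F (vsub e.1 (weight a)) e.1 a.1 a.2 u)
    else 0.

Lemma face00 e : @face0 e 0 = 0.
Proof. by rewrite /face0; case: e.2 => // a p; rewrite Fm0 gn0. Qed.

Lemma vsub_source (a : P n) (be : vec) :
  vsub (vadd (vadd a.2 be) a.1) (weight a) = be.
Proof. by apply: vecP => i; rewrite !vE; lia. Qed.

(** [LD] collects for one target the chains having it as a face, [leech_diff] distributes each chain
    over its faces. Both become sums over [L], compared face by face. *)
Lemma LD_leech_diff k L x X : Lchain k.+1 x -> LsuppBy L x -> represents x X ->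
  forall be q, LD k L x be q = leech_diff X (be, rev q).
Proof.
move=> [_ xk] xL xX be q.
have XE : X = \sum_(e <- undup L) gn (rev e.2) (x e.1 e.2).
  rewrite (@dsum_decomp _ _ X [seq (e.1, rev e.2) | e <- undup L]).
  - by rewrite big_map; apply: eq_bigr => e _; rewrite -xX.
  - rewrite map_inj_uniq ?undup_uniq // => -[a p] [b r] /= [-> h].
    by rewrite (can_inj revK h).
  move=> [al r] h; rewrite -(revK r) xX; apply: xL; apply: contraNN h => h.
  by apply/mapP; exists (al, rev r); rewrite ?mem_undup //= revK.
have leech_diffE : leech_diff X = \sum_(e <- undup L) face0 (x e.1 e.2) +
   \sum_(j < k) (\sum_(e <- undup L) gn (rev (mergeAt j e.2)) (x e.1 e.2)) *~
     sg j.+1 +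
   (\sum_(e <- undup L) gn (rev (take k e.2)) (x e.1 e.2)) *~ sg k.+1.
  rewrite XE raddf_sum /=; under [X in _ + X + _]eq_bigr =>
    j _ do rewrite mulrz_suml.
  rewrite exchange_big /= mulrz_suml -!big_split /=; apply: eq_bigr =>
    -[al p] _ /=.
  have [sp|sp] := eqVneq (size p) k.+1.
    by case: p sp => //= a p [sp]; exact: leech_diff_faces.
  rewrite xk ?(negPf sp) ?andbF // face00 !gn0 raddf0 big1 ?mul0rz ?addr0 // =>
    j _.
  by rewrite gn0 mul0rz.
have x0 e : e \notin undup L -> x e.1 e.2 = 0.
  by case: e => al p; rewrite mem_undup => h; exact: xL.
have t_uniq : uniq [seq (be, p) | p <- undup [seq e.2 | e <- L]].
  by rewrite map_inj_uniq ?undup_uniq // => p p' [].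
have nt e : e \in undup L -> e \notin [seq (be, p) | p <- undup [seq e.2 | e <-
  L]] ->
   e.1 != be.
  case: e => al p; rewrite mem_undup => h; apply: contraNneq => /= <-.
  by rewrite map_f // mem_undup; apply/mapP; exists (al, p).
(* Here [f] stands for a face that keeps the first object, and with it the coefficient: a
   composition or the last face. *)
have faceE (f : seq (P n) -> seq (P n)) :
  (\sum_(e <- undup L) gn (rev (f e.2)) (x e.1 e.2)) (be, rev q) =
  \sum_(p <- undup [seq e.2 | e <- L] | f p == q) x be p.
  rewrite -[LHS]/(coef (be, rev q) _) raddf_sum.
  rewrite (eq_big_supp (undup_uniq L) t_uniq); first last.
  - by move=> e _ /x0->; rewrite gn0 raddf0.
  - by move=> e eL /(nt _ eL); exact: coef_gn_neq.
  rewrite big_map [RHS]big_mkcond; apply: eq_bigr => p _.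
  by rewrite -[LHS]/(gn _ _ (be, rev q)) coef_gn (can_eq revK).
rewrite leech_diffE /LD -[RHS]/(coef (be, rev q) _) !(raddfD (coef _)).
rewrite (raddf_sum (coef _)) (raddf_sum (coef _)) (raddfMz (coef _)).
congr (_ + _ + _).
(* These are the only chains with face 0 equal to [(be, q)]: their first object is determined by
   [be] and the dropped morphism. *)
- pose t := [seq (vadd (vadd fg.2 be) fg.1, fg :: q)
             | fg <- undup [seq head (v0 n, v0 n) e.2 | e <- L]].
  have ut : uniq t by rewrite map_inj_uniq ?undup_uniq // => a b [].
  rewrite (eq_big_supp (undup_uniq L) ut); first last.
  + by move=> e _ /x0->; rewrite face00 raddf0.
  + move=> [al [|a p]] // eL et; rewrite -[LHS]/(gn (rev p)
      (Fm F (vsub al (weight a)) al a.1 a.2 (x al (a :: p))) (be, rev q)).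
    have [e1|] := eqVneq (vadd (vadd a.2 (vsub al (weight a))) a.1) al;
      last first.
      by move=> h; rewrite Fm_neq // gn0.
    apply: (@coef_dinj_neq _ Fix (_, rev p) (be, rev q)).
    apply: contraNneq et => -[e2 e3].
    have e4 : p = q by apply: (can_inj revK).
    apply/mapP; exists a; last by rewrite -e2 e1 e4.
    by rewrite mem_undup; apply/mapP; exists (al, a :: p);
      rewrite // -mem_undup.
  rewrite big_map; apply: eq_bigr => fg _; set al := vadd (vadd _ _) _.
  rewrite -[RHS]/(gn (rev q)
    (Fm F (vsub al (weight fg)) al fg.1 fg.2 (x al (fg :: q))) (be, rev q)).
  have -> : vsub al (weight fg) = be by exact: vsub_source.
  by rewrite coef_gn eqxx (FmE erefl).
- apply: eq_bigr => j _; rewrite sgnE (raddfMz (coef _)); congr (_ *~ _).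
  exact: esym (faceE (mergeAt j)).
rewrite sgnE; congr (_ *~ _); apply: etrans (esym (faceE (take k))).
(* The length condition in [LD] changes nothing here, since [x] vanishes on chains of any other
   length. *)
rewrite big_mkcond [RHS]big_mkcond; apply: eq_bigr => p _.
by case: eqVneq => //= sp; rewrite xk ?(negPf sp) ?andbF ?if_same.
Qed.

Lemma LBd_leech_diff k x y X : Lchain k.+1 x -> represents x X ->
  (LBd k x y <-> represents y (leech_diff X)).
Proof.
move=> xk xX; split=> [h be q|h L xL be q].
  by have [L xL] := xk.1; rewrite (h L xL) (LD_leech_diff xk xL xX).
by rewrite (LD_leech_diff xk xL xX) h.
Qed.

Lemma represents0 : represents (LC0 F) 0. Proof. by []. Qed.

Lemma leech_diff_nil X : in_supp (leech_deg 0) X -> leech_diff X = 0.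
Proof.
apply: (eq_additive_in (f := leech_diff) (g := \0)) => -[al [|a r]] /= u.
  by move=> _; rewrite gnE /leech_diff /= hdiff_nil parityE raddfMz /=
    drop_last_nil mul0rz addr0.
by rewrite /leech_deg andbF.
Qed.

Lemma Lcycle_leech_diff k x X : Lchain k x -> represents x X ->
  (Lcycle F k x <-> leech_diff X = 0).
Proof.
move=> xk xX; rewrite /Lcycle; case: k xk => [|k] xk.
  by split=> // _; apply: leech_diff_nil; apply: represents_in_supp xX.
split=> [[_ /(LBd_leech_diff _ xk xX) h]|h];
  first exact: represents_inj h represents0.
by split=> //; apply/(LBd_leech_diff _ xk xX); rewrite h.
Qed.

Lemma Lbound_leech_diff k x X : Lchain k x -> represents x X ->
  (Lbound F k x <-> exists2 Y, in_supp (leech_deg k.+1) Y & X = leech_diff Y).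
Proof.
move=> xk xX; split=> [[_ [y [yk yx]]]|[Y Yk XY]].
  have [Y yY] := Lchain_represents yk; exists Y;
    first exact: represents_in_supp yY.
  by apply: represents_inj xX _; apply/(LBd_leech_diff _ yk yY).
have yY : represents (fun al p => Y (al, rev p)) Y by [].
have yk := represents_Lchain Yk yY.
split=> //; exists (fun al p => Y (al, rev p)); split=> //.
by apply/(LBd_leech_diff _ yk yY); rewrite -XY.
Qed.

(** * The cubical complex *)

Definition cubical (y : CC F) : U := \sum_S gn [::] (y S).

Lemma indE (S : {set 'I_n}) i : ind S i = (i \in S) :> nat.
Proof. by rewrite ffunE. Qed.

Lemma ind_inj : injective (@ind n).
Proof.
move=> S T ST; apply/setP => i; move/eq_vec/(_ i): ST; rewrite !indE.
by case: (i \in S); case: (i \in T).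
Qed.

Lemma wsum_ind (S : {set 'I_n}) : wsum (ind S) = #|S|.
Proof.
rewrite /wsum -sum1_card [RHS]big_mkcond; apply: eq_bigr => i _; rewrite indE.
by case: (i \in S).
Qed.

Lemma cube_end_ind S : cube_end (ind S, [::]).
Proof.
rewrite /cube_end validr_nil endv_nil; apply/forallP => i; rewrite indE.
by case: (i \in S).
Qed.

Lemma cube_end_nil al : cube_end (al, [::]) -> al = ind [set i | al i == 1%N].
Proof.
rewrite /cube_end validr_nil endv_nil => /forallP h; apply: vecP => i.
by move: (h i); rewrite indE inE; case: (al i) => [|[]].
Qed.

Lemma coef_cubical y S : cubical y (ind S, [::]) = y S.
Proof.
rewrite -[LHS]/(coef (ind S, [::]) _) raddf_sum (bigD1 S) //= big1 ?addr0.
  by rewrite -[LHS]/(gn [::] (y S) (ind S, [::])) coef_gn eqxx.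
move=> T TS; apply: coef_gn_neq; apply: contraNneq TS => h.
by apply/eqP/ind_inj.
Qed.

Lemma eq_cubical y y' : (forall S, y S = y' S) -> cubical y = cubical y'.
Proof. by move=> h; apply: eq_bigr => S _; rewrite h. Qed.

Lemma cubical0 : cubical (CC0 F) = 0.
Proof. by apply: big1 => S _; exact: gn0. Qed.

Lemma cubicalD y y' : cubical (CCadd y y') = cubical y + cubical y'.
Proof. by rewrite -big_split; apply: eq_bigr => S _; exact: gnD. Qed.

Lemma cubicalN y : cubical (CCopp y) = - cubical y.
Proof. by rewrite -sumrN; apply: eq_bigr => S _; exact: raddfN. Qed.

Lemma cubical_nil y : in_supp nilx (cubical y).
Proof. by apply: in_supp_sum => S _; exact: in_supp_dinj. Qed.

Lemma cubical_tot_deg k y : in_supp (tot_deg k) (cubical y) <-> Cchain k y.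
Proof.
have tot_degE S : tot_deg k (ind S, [::]) = (#|S| == k).
  by rewrite /tot_deg cube_end_ind endv_nil wsum_ind.
split=> h; first by move=> S Sk; rewrite -coef_cubical h // tot_degE.
apply: in_supp_sum => S _; have [Sk|Sk] := eqVneq #|S| k.
  by apply: in_supp_dinj; rewrite tot_degE Sk.
by rewrite h // gn0.
Qed.

Lemma nil_cubical k X : in_supp (tot_deg k) X -> in_supp nilx X ->
  X = cubical (fun S => X (ind S, [::])).
Proof.
move=> TX nX; apply: dsum_ext => -[al [|a r]]; last first.
  by rewrite nX // cubical_nil.
have [D|nD] := boolP (cube_end (al, [::])).
  by rewrite (cube_end_nil D) coef_cubical.
rewrite [LHS]TX; last by rewrite /tot_deg negb_and nD.
rewrite -[RHS]/(coef (al, [::]) _) raddf_sum big1 // => S _.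
by apply: coef_gn_neq; apply: contraNneq nD => <-; exact: cube_end_ind.
Qed.

Lemma gnB al r (u v : F al) : gn r u - gn r v = gn r (u - v).
Proof. by rewrite /gn raddfB. Qed.

Lemma gnMz al r (u : F al) m : gn r u *~ m = gn r (u *~ m).
Proof. by rewrite /gn raddfMz. Qed.

Lemma vdiff_nil al (u : F al) :
  vdiff (gn [::] u) = \sum_i - (diff i (gn [::] u) *~ chi i al).
Proof.
rewrite /vdiff -sumrN; apply: eq_bigr => i _.
by rewrite parityE mulr1z dg_endE endv_nil raddfMz.
Qed.

Lemma cnt_ind (i : 'I_n) (T : {set 'I_n}) :
  cnt i (ind (i |: T)) = #|[set j in T | (j < i)%N]|.
Proof.
rewrite /cnt; apply: eq_card => j; rewrite !inE indE !inE.
have [->|_] := eqVneq j i; first by rewrite ltnn andbF.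
by rewrite andbC; case: (j \in T).
Qed.

(** The sum over a cube [S] and a direction [i] in it is reindexed by the face [T] and [i] outside
    [T], with [S = i |: T]. Removing [i] then has the sign given by the elements of [T] below
    [i]. *)
Lemma vdiff_cubical y : vdiff (cubical y) = cubical (CD y).
Proof.
transitivity (\sum_i \sum_(T : {set 'I_n} | i \notin T)
  - (diff i (gn [::] (y (i |: T))) *~ chi i (ind (i |: T)))).
  rewrite /cubical raddf_sum /=; under eq_bigr => S _ do rewrite vdiff_nil.
  rewrite exchange_big /=; apply: eq_bigr => i _.
  rewrite (bigID (fun S : {set 'I_n} => i \in S)) /= [X in _ + X]big1 ?addr0.
    rewrite (reindex_onto (fun T => i |: T) (fun S => S :\ i)) /=; last first.
      by move=> S iS; rewrite setD1K.
    apply: eq_bigl => T; rewrite setU11 /=; apply/eqP/idP => [<-|iT].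
      by rewrite !inE eqxx.
    exact: setU1K.
  by move=> S iS; rewrite /chi indE (negPf iS) /= mulr0z oppr0.
rewrite (exchange_big_dep predT) //=; apply: eq_bigr => T _.
rewrite /CD -[RHS]/(dinj _) raddf_sum /=; apply: eq_bigr => i iT.
rewrite sgnE -[RHS]/(gn _ _) -gnMz -gnB sgS mulrNz; congr (- (_ *~ _));
  last first.
  by rewrite /chi indE setU11 /= cnt_ind.
rewrite /diff /= !act_nil weight0g weightg0.
suff -> : vsub (ind (i |: T)) (gen i) = ind T by [].
apply: vecP => j; rewrite vsubE !indE genE !inE.
by have [->|_] := eqVneq j i; [rewrite (negPf iT) | rewrite subn0].
Qed.

Lemma tdiff_cubical y : tdiff (cubical y) = cubical (CD y).
Proof.
rewrite /tdiff /= vdiff_cubical /cubical raddf_sum big1 ?add0r // => S _ /=.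
exact: hdiff_nil.
Qed.

Lemma Ccycle_tdiff k y :
  Ccycle F k y <-> in_supp (tot_deg k) (cubical y) /\ tdiff (cubical y) = 0.
Proof.
rewrite tdiff_cubical; split=> [[/cubical_tot_deg yk h]|[/cubical_tot_deg yk
  h]]; split=> //.
  by rewrite -cubical0; apply: eq_cubical.
by move=> T; rewrite -coef_cubical h.
Qed.

Lemma augm_leech_deg k z : in_supp (tot_deg k.+1) z ->
  in_supp (leech_deg k) (augm z).
Proof.
elim/in_supp_ind => [|x y hx hy|[al r] u].
- by rewrite raddf0.
- by rewrite raddfD; exact: in_suppD.
rewrite gnE /= => /andP[/andP[vi _] /eqP sz].
rewrite /augm /= dg_endE /isz; case: eqP => [e0|_];
  last by rewrite mulr0z raddf0.
rewrite mulr1z; case: r u vi sz e0 => [|a r] u vi sz e0;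
  first by rewrite drop_last_nil.
rewrite drop_last_cons; apply: in_supp_dinj; rewrite /leech_deg.
move: vi; rewrite validr_cons => /andP[-> _] /=; rewrite e0 in sz.
have w0 : wsum (v0 n) = 0%N by rewrite /wsum big1 // => i _; rewrite v0E.
by rewrite w0 addn0 /= in sz; case: sz => ->.
Qed.

Lemma augm_sec_tot_deg k x : in_supp (leech_deg k) x ->
  in_supp (tot_deg k.+1) (augm_sec x).
Proof.
elim/in_supp_ind => [|y z hy hz|[al r] u].
- by rewrite raddf0.
- by rewrite raddfD; exact: in_suppD.
rewrite gnE /= => /andP[vi /eqP sz]; rewrite augm_secE; apply: in_supp_dinj.
have w0 : wsum (v0 n) = 0%N by rewrite /wsum big1 // => i _; rewrite v0E.
rewrite /tot_deg /cube_end endv_augm_sec w0 addn0 /= -sz eqxx andbT validr_cons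
  vi /=.
apply/andP; split; last by apply/forallP => i; rewrite v0E.
by apply/vleP => i; rewrite weightE v0E addn0.
Qed.

End Complexes.

(** * The correspondence between Leech cycles and cubical cycles *)

Theorem mainTheorem2 (n : nat) (F : natsys n) (k : nat) :
  subquot_iso (LC0 F) (@LCadd n F) (@LCopp n F) (Lcycle F k) (Lbound F k)
              (CC0 F) (@CCadd n F) (@CCopp n F) (Ccycle F k) (Cbound F k).
Proof.
(* This is the graph, on cycles, of the connecting homomorphism for the chains of length 0 inside
   the total complex, with the quotient compared to the Leech complex by [augm]. *)
exists (fun x y => exists Z, [/\ in_supp (@tot_deg n k.+1) Z, tdiff Z = cubical
  y &
                                 represents x (augm Z)]).
have RZ x y Z : in_supp (@tot_deg n k.+1) Z -> tdiff Z = cubical y ->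
  represents x (augm Z) ->
    Lcycle F k x /\ Ccycle F k y.
  move=> TZ dZ xZ; have xk := represents_Lchain (augm_leech_deg TZ) xZ; split.
    by apply/(Lcycle_leech_diff xk xZ); rewrite -augm_tdiff dZ augm_nil //;
      exact: cubical_nil.
  by apply/Ccycle_tdiff; rewrite -dZ tdiff_tdiff; split=> //;
    exact: tdiff_tot_deg.
split.
  by exists 0; rewrite !raddf0 cubical0; split=> //; exact: in_supp0.
split.
  move=> x y x' y' [Z [TZ dZ xZ]] [Z' [TZ' dZ' xZ']]; exists (Z + Z').
  split; first exact: in_suppD.
    by rewrite raddfD /= dZ dZ' cubicalD.
  by move=> al p; rewrite /LCadd -xZ -xZ' raddfD.
split.
  move=> x y [Z [TZ dZ xZ]]; exists (- Z).
  split; first exact: in_suppN.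
    by rewrite raddfN /= dZ cubicalN.
  by move=> al p; rewrite /LCopp -xZ raddfN.
split; first by move=> x y [Z [TZ dZ xZ]]; exact: RZ xZ.
split.
  move=> x cx; have xk := cx.1; have [X xX] := Lchain_represents xk.
  have Xk := represents_in_supp xk xX; have /(Lcycle_leech_diff xk xX) bX := cx.
  have TkX := augm_sec_tot_deg Xk.
  (* The lift [augm_sec X] has a boundary of augmentation [leech_diff X = 0]. Correcting the lift by
     [w] moves that boundary into length 0 and keeps the augmentation [X]. *)
  have [|||w [Tw nw ew]] := @column_acyclic _ _ k (tdiff (augm_sec X)).
  - exact: tdiff_tot_deg.
  - by rewrite tdiff_tdiff; exact: in_supp0.
  - by rewrite augm_tdiff augm_augm_sec bX.
  exists (fun S => tdiff (augm_sec X - w) (ind S, [::]));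
    exists (augm_sec X - w).
  have TZ : in_supp (@tot_deg n k.+1) (augm_sec X - w) by exact: in_suppB.
  split=> //; first by apply: (@nil_cubical _ _ k);
    [exact: tdiff_tot_deg | rewrite raddfB].
  by rewrite raddfB /= augm_augm_sec ew subr0.
split.
  move=> y /Ccycle_tdiff[Ty dy]; have [Z TZ dZ] := row_acyclic Ty dy.
  by exists (fun al p => augm Z (al, rev p)); exists Z; split.
move=> x y [Z [TZ dZ xZ]]; have [cx cy] := RZ _ _ _ TZ dZ xZ.
rewrite (Lbound_leech_diff cx.1 xZ); split=> [[Y Yk eY]|[_ [y' [y'k yy']]]].
  split; first exact: cy.1.
  have TkY := augm_sec_tot_deg Yk.
  (* Subtracting the boundary of a lift of [Y] kills the augmentation of [Z]; then [Z] can be moved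
     into length 0 with its boundary unchanged, and there it is a cubical chain bounding [y]. *)
  have [|||w [Tw nw ew]] := @column_acyclic _ _ k.+1 (Z - tdiff (augm_sec Y)).
  - by apply: in_suppB => //; exact: tdiff_tot_deg.
  - by rewrite raddfB /= tdiff_tdiff subr0 dZ; exact: cubical_nil.
  - by rewrite raddfB /= augm_tdiff augm_augm_sec eY subrr.
  set Z' := Z - tdiff (augm_sec Y) - tdiff w in nw.
  have TZ' : in_supp (@tot_deg n k.+1) Z'.
    by do 2![apply: in_suppB; last exact: tdiff_tot_deg].
  have eZ' := nil_cubical TZ' nw.
  exists (fun S => Z' (ind S, [::])); split.
    by apply/cubical_tot_deg; rewrite -eZ'.
  have dZ' : tdiff Z' = tdiff Z by rewrite 2!(raddfB (@tdiff n F)) /=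
    !tdiff_tdiff !subr0.
  by move=> T; rewrite -(coef_cubical y) -(coef_cubical (CD _)) -tdiff_cubical
    -eZ' dZ' dZ.
(* [Z - cubical y'] is a cycle of the acyclic total complex, and its augmentation is still that of
   [Z]; the augmentation of [w] therefore bounds it. *)
have [||w Tw ew] := @row_acyclic _ _ k.+1 (Z - cubical y').
- by apply: in_suppB => //; apply/cubical_tot_deg.
- by rewrite raddfB /= dZ tdiff_cubical (eq_cubical yy') subrr.
exists (augm w); first exact: augm_leech_deg.
rewrite -augm_tdiff -ew raddfB /= [X in _ - X]augm_nil ?subr0 //;
  exact: cubical_nil.
Qed.
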